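(* For all positive integers $n$ and $j$ and all primes $p$ in the indicated range, $$P_{6,1,0,\ldots,0,-4}(p^jn-\ell)\equiv0\pmod{p^{2j}},\qquad 5\le p\le101,$$ and $$P_{4,-2,0,\ldots,0,1,-2,1}(p^jn-\ell)\equiv0\pmod{p^j},\qquad 11\le p\le101,$$ $$P_{4,-2,0,\ldots,0,1,-1}(p^jn-\ell)\equiv0\pmod{p^j},\qquad 11\le p\le101,$$ $$P_{4,1,1,0,\ldots,0,-2,-2}(p^jn-\ell)\equiv0\pmod{p^j},\qquad 11\le p\le101.$$ Here each subscript vector $(a_0,a_1,\ldots,a_{(p-1)/2})$ has length $(p+1)/2$, with as many zeros in place of $0,\ldots,0$ as needed, and $\ell=\ell(a_0,\ldots,a_{(p-1)/2})$ for the respective subscript vector.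
   Context: Let $(a;q)_\infty=\prod_{n\ge 1}(1-aq^{n-1})$, $(a,b;q)_\infty=(a;q)_\infty(b;q)_\infty$, $\langle r\rangle=r-\lfloor r\rfloor$. For a prime $p\ge5$ and integers $a_0,\ldots,a_{(p-1)/2}$, the integers $P_{a_0,\ldots,a_{(p-1)/2}}(n)$ are defined by $$(q^p;q^p)_\infty^{a_0}\prod_{i=1}^{(p-1)/2}(q^i,q^{p-i};q^p)_\infty^{a_i}=\sum_{n=0}^\infty P_{a_0,\ldots,a_{(p-1)/2}}(n)q^n,$$ with $P_{a_0,\ldots,a_{(p-1)/2}}(n)=0$ for $n<0$, and $$\ell(a_0,\ldots,a_{(p-1)/2})=\frac{p}{24}\Bigl(a_0+2\sum_{i=1}^{(p-1)/2}a_i\Bigr)-\frac p2\sum_{i=1}^{(p-1)/2}\Bigl\langle\frac ip\Bigr\rangle\Bigl(1-\Bigl\langle\frac ip\Bigr\rangle\Bigr)a_i.$$ *)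

(* Defs.v *)
From HB Require Import structures.
From mathcomp Require Import all_boot all_order all_algebra.
From mathcomp Require Import boolp.

Set Implicit Arguments.
Unset Strict Implicit.
Unset Printing Implicit Defensive.

Import Order.TTheory GRing.Theory Num.Theory.
Local Open Scope ring_scope.

Record fps (R : Type) := Fps { coefs : nat -> R }.

Lemma fpsP (R : Type) (f g : fps R) : coefs f =1 coefs g -> f = g.
Proof. by case: f g => [f] [g] /= fg; congr Fps; apply: funext. Qed.

HB.instance Definition _ (R : Type) := gen_eqMixin (fps R).
HB.instance Definition _ (R : Type) := gen_choiceMixin (fps R).

Section FpsRing.
Variable R : comUnitRingType.
Implicit Types f g h : fps R.

Definition fps_zero : fps R := Fps (fun=> 0).
Definition fps_opp f : fps R := Fps (fun n => - coefs f n).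
Definition fps_add f g : fps R := Fps (fun n => coefs f n + coefs g n).

Lemma fps_addA : associative fps_add.
Proof. by move=> f g h; apply: fpsP => n /=; rewrite addrA. Qed.
Lemma fps_addC : commutative fps_add.
Proof. by move=> f g; apply: fpsP => n /=; rewrite addrC. Qed.
Lemma fps_add0 : left_id fps_zero fps_add.
Proof. by move=> f; apply: fpsP => n /=; rewrite add0r. Qed.
Lemma fps_addN : left_inverse fps_zero fps_opp fps_add.
Proof. by move=> f; apply: fpsP => n /=; rewrite addNr. Qed.

HB.instance Definition _ :=
  GRing.isZmodule.Build (fps R) fps_addA fps_addC fps_add0 fps_addN.

Definition fps_one : fps R := Fps (fun n => (n == 0%N)%:R).
Definition fps_mul f g : fps R :=
  Fps (fun n => \sum_(i < n.+1) coefs f i * coefs g (n - i)%N).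

Definition fps_trunc N f : {poly R} := \poly_(i < N) coefs f i.

Lemma coef_fps_trunc N f i :
  (i < N)%N -> (fps_trunc N f)`_i = coefs f i.
Proof. by move=> iN; rewrite coef_poly iN. Qed.

Lemma fps_truncM N f g i : (i < N)%N ->
  coefs (fps_mul f g) i = (fps_trunc N f * fps_trunc N g)`_i.
Proof.
move=> iN; rewrite coefM /=; apply: eq_bigr => k _.
by rewrite !coef_fps_trunc ?(leq_ltn_trans _ iN) ?leq_subr // -ltnS.
Qed.

Lemma fps_mulC : commutative fps_mul.
Proof.
by move=> f g; apply: fpsP => n; rewrite !(@fps_truncM n.+1) // mulrC.
Qed.

Lemma fps_mulA : associative fps_mul.
Proof.
move=> f g h; apply: fpsP => n.
have truncM u v : forall i, (i < n.+1)%N ->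
    (fps_trunc n.+1 (fps_mul u v))`_i
    = (fps_trunc n.+1 u * fps_trunc n.+1 v)`_i.
  by move=> i iN; rewrite coef_fps_trunc // (fps_truncM _ _ iN).
transitivity ((fps_trunc n.+1 f * (fps_trunc n.+1 g * fps_trunc n.+1 h))`_n).
  rewrite (@fps_truncM n.+1) // !coefM; apply: eq_bigr => k _.
  by rewrite truncM // ltnS leq_subr.
rewrite mulrA (@fps_truncM n.+1) // !coefM; apply: eq_bigr => k _.
by rewrite truncM.
Qed.

Lemma fps_mul1 : left_id fps_one fps_mul.
Proof.
move=> f; apply: fpsP => n /=.
rewrite big_ord_recl /= mul1r subn0 big1 ?addr0 // => i _.
by rewrite mul0r.
Qed.

Lemma fps_mulD : left_distributive fps_mul fps_add.
Proof.
move=> f g h; apply: fpsP => n /=; rewrite -big_split /=.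
by apply: eq_bigr => i _; rewrite mulrDl.
Qed.

Lemma fps_one_neq0 : fps_one != 0.
Proof.
by apply/eqP => /(congr1 (fun f => coefs f 0)) /= /eqP; rewrite oner_eq0.
Qed.

HB.instance Definition _ := GRing.Zmodule_isComNzRing.Build (fps R)
  fps_mulA fps_mulC fps_mul1 fps_mulD fps_one_neq0.

Definition fpsC (c : R) : fps R := Fps (fun n => if n is 0 then c else 0).

(* The indeterminate q. *)
Definition fpsX : fps R := Fps (fun n => (n == 1%N)%:R).

Lemma coefs0 n : coefs (0 : fps R) n = 0. Proof. by []. Qed.
Lemma coefs1 n : coefs (1 : fps R) n = (n == 0%N)%:R. Proof. by []. Qed.
Lemma coefsN f n : coefs (- f) n = - coefs f n. Proof. by []. Qed.
Lemma coefsD f g n : coefs (f + g) n = coefs f n + coefs g n.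
Proof. by []. Qed.
Lemma coefsM f g n :
  coefs (f * g) n = \sum_(i < n.+1) coefs f i * coefs g (n - i)%N.
Proof. by []. Qed.
Lemma coefsM0 f g : coefs (f * g) 0 = coefs f 0 * coefs g 0.
Proof. by rewrite coefsM big_ord1. Qed.

Lemma coefs_sum I (r : seq I) (P : pred I) (F : I -> fps R) n :
  coefs (\sum_(i <- r | P i) F i) n = \sum_(i <- r | P i) coefs (F i) n.
Proof. by elim/big_rec2: _ => // i _ x _ <-. Qed.

Lemma coefsCM c f n : coefs (fpsC c * f) n = c * coefs f n.
Proof.
rewrite coefsM big_ord_recl /= subn0 big1 ?addr0 // => i _.
by rewrite mul0r.
Qed.

(* A power series without constant term has k-th power in q^k R[[q]]. *)
Lemma coefsX_small f k n :
  coefs f 0 = 0 -> (n < k)%N -> coefs (f ^+ k) n = 0.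
Proof.
move=> f0; elim: k n => // k IHk n; rewrite ltnS => nk.
rewrite exprS coefsM big1 // => -[[|i] /= ilt] _; first by rewrite f0 mul0r.
rewrite IHk ?mulr0 //; apply: leq_trans nk.
by rewrite ltn_subLR // addSn ltnS leq_addl.
Qed.

(* With c = f(0)^-1 and u = 1 - c f, one has f^-1 = c (1 + u + u^2 + ...), and
   u^k contributes to the coefficient of q^n only when k <= n. *)
Definition fps_unit : pred (fps R) := fun f => coefs f 0 \is a GRing.unit.
Definition fps_inv f : fps R :=
  if fps_unit f then
    let c := fpsC (coefs f 0)^-1 in
    Fps (fun n => coefs (c * \sum_(k < n.+1) (1 - c * f) ^+ k) n)
  else f.

Lemma fps_mulVf : {in fps_unit, left_inverse 1 fps_inv *%R}.
Proof.
move=> f; rewrite unfold_in => fU; rewrite /fps_inv /fps_unit fU.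
set c := fpsC _; set u := 1 - c * f.
have u0 : coefs u 0 = 0 by rewrite coefsD coefsN coefsCM (mulVr fU) subrr.
have stab n m : (m <= n)%N ->
    coefs (\sum_(k < m.+1) u ^+ k) m = coefs (\sum_(k < n.+1) u ^+ k) m.
  move=> mn; rewrite !coefs_sum.
  rewrite -!(big_mkord xpredT (fun k => coefs (u ^+ k) m)).
  rewrite [RHS](@big_cat_nat _ _ _ m.+1) //=.
  rewrite [X in _ + X]big_nat_cond [X in _ + X]big1 ?addr0 // => k.
  by rewrite andbT => /andP[mk _]; rewrite coefsX_small.
apply: fpsP => n.
transitivity (coefs ((c * \sum_(k < n.+1) u ^+ k) * f) n).
  rewrite !coefsM; apply: eq_bigr => i _; congr (_ * _).
  rewrite -[LHS]/(coefs (c * \sum_(k < i.+1) u ^+ k) i).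
  by rewrite !coefsCM (stab n) // -ltnS.
rewrite mulrAC [X in coefs (X * _) n](_ : _ = 1 - u); last first.
  by rewrite /u opprB addrCA subrr addr0.
by rewrite -opprB mulNr -subrX1 opprB coefsD coefsN coefsX_small // subr0.
Qed.

Lemma fps_unitPl f g : g * f = 1 -> fps_unit f.
Proof.
move=> /(congr1 (fun h => coefs h 0)); rewrite coefsM0 coefs1 eqxx => gf.
by apply/unitrPr; exists (coefs g 0); rewrite mulrC.
Qed.

Lemma fps_inv_out : {in [predC fps_unit], fps_inv =1 id}.
Proof.
by move=> f /negbTE fU; rewrite /fps_inv -[fps_unit f]/(f \in fps_unit) fU.
Qed.

HB.instance Definition _ := GRing.ComNzRing_hasMulInverse.Build (fps R)
  fps_mulVf fps_unitPl fps_inv_out.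

(* (a; x)_oo for a and x without constant term: the factor 1 - a x^k is then
   congruent to 1 modulo q^(k+1), so the partial products are stationary at
   each coefficient (see [qpoch_stable]). *)
Definition qpoch (a x : fps R) : fps R :=
  Fps (fun n => coefs (\prod_(k < n.+1) (1 - a * x ^+ k)) n).

Lemma qpoch_stable a x n N : coefs a 0 = 0 -> coefs x 0 = 0 -> (n < N)%N ->
  coefs (\prod_(k < N) (1 - a * x ^+ k)) n = coefs (qpoch a x) n.
Proof.
move=> a0 x0; elim: N => // N IHN; rewrite ltnS leq_eqVlt => /orP[/eqP->//|nN].
rewrite big_ord_recr [X in coefs X _ = _]/= mulrBr mulr1 coefsD coefsN IHN //.
rewrite mulrA.
rewrite [X in _ - X]coefsM big1 ?subr0 // => -[[|i] ilt] _.
  by rewrite [X in X * _]coefsM0 a0 mulr0 mul0r.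
by rewrite (coefsX_small x0) ?mulr0 // (leq_ltn_trans _ nN) // leq_subr.
Qed.

Lemma qpoch_unit a x : coefs a 0 = 0 -> qpoch a x \is a GRing.unit.
Proof.
move=> a0; suff: coefs (qpoch a x) 0 \is a GRing.unit by [].
rewrite -[coefs _ 0]/(coefs (\prod_(k < 1) (1 - a * x ^+ k)) 0) big_ord1.
by rewrite coefsD coefsN coefsM0 a0 mul0r subr0 coefs1 unitr1.
Qed.

Definition qpoch2 (a b x : fps R) : fps R := qpoch a x * qpoch b x.

End FpsRing.

Arguments fpsX {R}.

(* The subscript vector (a_0, ..., a_((p-1)/2)) is the sequence a, and a`_i is
   a_i. *)
Definition Pgen (p : nat) (a : seq int) : fps int :=
  qpoch (fpsX ^+ p) (fpsX ^+ p) ^ a`_0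
  * \prod_(1 <= i < (p.-1./2).+1)
      qpoch2 (fpsX ^+ i) (fpsX ^+ (p - i)) (fpsX ^+ p) ^ a`_i.

Definition Pcoef (p : nat) (a : seq int) (n : int) : int :=
  match n with Posz k => coefs (Pgen p a) k | Negz _ => 0 end.

Definition frac (r : rat) : rat := r - (Num.floor r)%:~R.

Definition ell (p : nat) (a : seq int) : rat :=
  p%:R / 24%:R
    * ((a`_0)%:~R + 2%:R * \sum_(1 <= i < (p.-1./2).+1) (a`_i)%:~R)
  - p%:R / 2%:R
    * \sum_(1 <= i < (p.-1./2).+1)
        frac (i%:R / p%:R) * (1 - frac (i%:R / p%:R)) * (a`_i)%:~R.

(* The vector (u, 0, ..., 0, v) of length (p+1)/2. *)
Definition zpad (p : nat) (u v : seq int) : seq int :=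
  u ++ nseq (p.+1./2 - (size u + size v)) 0 ++ v.

Lemma size_zpad p u v :
  (size u + size v <= p.+1./2)%N -> size (zpad p u v) = p.+1./2.
Proof. by move=> le; rewrite !size_cat size_nseq addnCA subnK. Qed.

(* P_a(p^j n - ell) = 0 (mod p^e).  As ell is a rational number, that
   p^j n - ell is an integer is part of the assertion. *)
Definition P_dvd (p : nat) (a : seq int) (j n e : nat) : Prop :=
  exists2 m : int,
    m%:~R = (p ^ j * n)%:R - ell p a & (Pcoef p a m = 0 %[mod (p ^ e)%:Z])%Z.

(* Main.v *)
Require Import Defs.
From mathcomp Require Import all_boot all_order all_algebra.
From mathcomp Require Import ring zify.
Import GRing.Theory.
Local Open Scope ring_scope.

Set Implicit Arguments.
Unset Strict Implicit.
Unset Printing Implicit Defensive.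

(** Put Q = q^p, h = (p-1)/2, and let theta(x) = (x, Q/x; Q)_oo, which times
    (Q; Q)_oo is the odd Jacobi theta function up to a monomial.  Each of the
    four products is, up to a power of q, an elliptic function evaluated at
    powers of q:

    - (Q;Q)^6 theta(x^2) / theta(x)^4 is the derivative of the Weierstrass
      function; with x = q^h one has x^2 = q^(p-1), and theta(q^(p-1)) =
      theta(q), so this is the vector (6, 1, 0, ..., 0, -4);
    - (Q;Q)^4 theta(xy) theta(y/x) / (theta(x)^2 theta(y)^2) is a difference of
      two values of the Weierstrass function; (x, y) = (q, q^(h-1)), (q, q^h)
      and (q^(h-1), q^h) give the three other vectors.

    Elliptic functions have Lambert series.  Writing
      wp(x) = sum_(k >= 0) (X_k / (1 - X_k)^2 + Z_k / (1 - Z_k)^2)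
    with X_k = x Q^k and Z_k = Q^(k+1) / x, the coefficient of q^N in wp(q^a)
    is the sum of m over the factorisations N = m e with e congruent to a or -a
    modulo p; for the derivative the weights are m^2 and -m^2.  When
    N = p^j n and p does not divide a, every such e is prime to p, so p^j
    divides m.  The shift ell is precisely the power of q in front of the
    product, so the argument p^j n - ell of the coefficient becomes p^j n.

    It remains to prove the two product formulas inside Z[[q]], without complex
    analysis.

    - By Jacobi's triple product ([triple_product]) theta is, up to a constant,
      the series sum_n (-1)^n Q^(n(n-1)/2) x^n.  Sorting the pairs of summation
      indices by the parity of their sum turns x theta(xy) theta(y/x) into a
      2 x 2 determinant in x and y ([theta_series_mul]).
    - The Pluecker relation between the 2 x 2 minors at the four points
      1, u, x, y is then the three-term identity ([theta_three_term])
        theta(u)^2 x theta(xy) theta(y/x)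
          = u (theta(x)^2 theta(uy) theta(y/u) - theta(y)^2 theta(ux) theta(x/u)).
    - Let u = 1 + t with t a second indeterminate.  Since
      (1 - uX)(1 - X/u) = (1 - X)^2 - (t^2/u) X, one finds
      theta(ux) theta(x/u) = theta(x)^2 (1 - t^2 wp(x) + O(t^3)), and
      theta(u)^2 = t^2 (Q;Q)^4 + O(t^3).  The coefficient of t^2 in the
      three-term identity is the formula for wp(x) - wp(y) ([wp_sub]).
    - Taking x = (1 + t) y in that formula, theta(y/x) acquires a factor t, and
      the coefficient of t is the formula for the derivative ([wp_derivE]).

    For this reason theta is defined at the points c q^a with c a unit of an
    arbitrary coefficient ring R: the deformations above are instances with
    coefficients in power series in t. *)

(** * Power series modulo a power of q *)
Section Congruence.
Variable R : comUnitRingType.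
Implicit Types f g : fps R.

Definition eqm M f g := forall i, (i < M)%N -> coefs f i = coefs g i.

Lemma eqm_refl M f : eqm M f f. Proof. by []. Qed.
Lemma eqm_sym M f g : eqm M f g -> eqm M g f.
Proof. by move=> fg i iM; rewrite fg. Qed.
Lemma eqm_trans M f g h : eqm M f g -> eqm M g h -> eqm M f h.
Proof. by move=> fg gh i iM; rewrite fg // gh. Qed.
Lemma eqm_leq M N f g : (M <= N)%N -> eqm N f g -> eqm M f g.
Proof. by move=> MN fg i iM; apply: fg; apply: leq_trans MN. Qed.
Lemma eqmD M f1 f2 g1 g2 : eqm M f1 g1 -> eqm M f2 g2 ->
  eqm M (f1 + f2) (g1 + g2).
Proof. by move=> h1 h2 i iM; rewrite !coefsD h1 // h2. Qed.
Lemma eqmM M f1 f2 g1 g2 : eqm M f1 g1 -> eqm M f2 g2 ->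
  eqm M (f1 * f2) (g1 * g2).
Proof.
move=> h1 h2 i iM; rewrite !coefsM; apply: eq_bigr => k _.
by rewrite h1 ?h2 // (leq_ltn_trans _ iM) ?leq_subr // -ltnS.
Qed.

Lemma eqm_all f g : (forall M, eqm M f g) -> f = g.
Proof. by move=> fg; apply: fpsP => i; apply: (fg i.+1). Qed.

Lemma eqmMr_inv M f g u : u \is a GRing.unit -> eqm M (f * u) (g * u) -> eqm M f g.
Proof.
move=> uU fg; rewrite -[f](mulrK uU) -[g](mulrK uU).
exact: eqmM fg (@eqm_refl M u^-1).
Qed.

Lemma fps_unitE f : (f \is a GRing.unit) = (coefs f 0 \is a GRing.unit).
Proof. by []. Qed.

Definition mono (c : R) (e : nat) : fps R := Fps (fun n => c *+ (n == e)).

Lemma coefs_monoM c e f n :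
  coefs (mono c e * f) n = if (e <= n)%N then c * coefs f (n - e)%N else 0.
Proof.
rewrite coefsM; case: leqP => en.
  rewrite (bigD1 (Ordinal (en : e < n.+1)%N)) //= eqxx mulr1n big1 ?addr0 // => i ne.
  rewrite (_ : (_ == e) = false) ?mulr0n ?mul0r //.
  by apply/negbTE; apply: contra ne => /eqP ie; apply/eqP/val_inj.
rewrite big1 // => i _ /=; rewrite (_ : (_ == e) = false) ?mulr0n ?mul0r //.
by apply/negbTE; rewrite neq_ltn (leq_ltn_trans _ en) // -ltnS.
Qed.

Lemma mono1 : mono 1 0 = 1.
Proof. by apply: fpsP => -[|n]. Qed.

Lemma monoM c d e e2 : mono c e * mono d e2 = mono (c * d) (e + e2).
Proof.
apply: fpsP => n; rewrite coefs_monoM /=; case: leqP => en.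
  by rewrite -mulrnAr; congr (_ * (_ *+ _)); lia.
by rewrite (_ : (_ == _)%N = false) //; lia.
Qed.

Lemma monoX c e k : mono c e ^+ k = mono (c ^+ k) (k * e).
Proof.
elim: k => [|k IH]; first by rewrite !expr0 mul0n mono1.
by rewrite !exprS IH monoM mulSn.
Qed.

Lemma fpsX_mono k : (fpsX : fps R) ^+ k = mono 1 k.
Proof.
have -> : fpsX = mono 1 1 by apply: fpsP => -[|[|n]].
by rewrite monoX expr1n muln1.
Qed.

Lemma mono_eqm0 M c e : (M <= e)%N -> eqm M (mono c e) 0.
Proof. by move=> Me i iM /=; rewrite (_ : (_ == _)%N = false) //; lia. Qed.

Lemma eqm_monoM0 M c e f : (M <= e)%N -> eqm M (mono c e * f) 0.
Proof.
move=> Me; rewrite -[0](mul0r f).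
exact: eqmM (mono_eqm0 c Me) (@eqm_refl M f).
Qed.

(** The factor at index k is 1 modulo the k-th power of x, whatever the
    constant coefficient of a; the case of a unit a is needed for theta near
    x = 1. *)
Lemma qpoch_eqm (a x : fps R) N : coefs x 0 = 0 ->
  eqm N (qpoch a x) (\prod_(k < N) (1 - a * x ^+ k)).
Proof.
move=> x0 n; elim: N => // N IH; rewrite ltnS leq_eqVlt => /orP[/eqP->//|nN].
rewrite IH // big_ord_recr [X in _ = coefs X _]/= mulrBr mulr1 coefsD coefsN.
rewrite mulrA [X in _ - X]coefsM.
rewrite [X in _ - X]big1 ?subr0 // => -[i /= ilt] _.
by rewrite (coefsX_small x0) ?mulr0 //; lia.
Qed.

End Congruence.

(** * Gaussian binomials and Jacobi's triple product *)
Section Gauss.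
Variable R : comUnitRingType.
Variable p : nat.
Hypothesis p_gt0 : (0 < p)%N.

Definition Qp : fps R := mono 1 p.
Lemma QpX k : Qp ^+ k = mono 1 (k * p). Proof. by rewrite monoX expr1n. Qed.
Lemma Qp0 : coefs Qp 0 = 0.
Proof. by rewrite /= (_ : (_ == _)%N = false) //; lia. Qed.
Lemma QpX0 k : coefs (Qp ^+ k.+1) 0 = 0.
Proof. by rewrite QpX /= (_ : (_ == _)%N = false) // eq_sym; lia. Qed.

Definition qfac n : fps R := \prod_(k < n) (1 - Qp ^+ k.+1).
Definition euler : fps R := qpoch Qp Qp.

Lemma qfac0 : qfac 0 = 1. Proof. by rewrite /qfac big_ord0. Qed.
Lemma qfacS n : qfac n.+1 = qfac n * (1 - Qp ^+ n.+1).
Proof. by rewrite /qfac big_ord_recr. Qed.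

Lemma one_sub_unit (f : fps R) : coefs f 0 = 0 -> 1 - f \is a GRing.unit.
Proof. by move=> f0; rewrite fps_unitE coefsD coefsN f0 subr0 unitr1. Qed.

Lemma qfac_unit n : qfac n \is a GRing.unit.
Proof. by rewrite rpred_prod // => i _; apply/one_sub_unit/QpX0. Qed.

Lemma euler_unit : euler \is a GRing.unit.
Proof. by apply: qpoch_unit; apply: Qp0. Qed.

Lemma qfac_eqm n : eqm n.+1 (qfac n) euler.
Proof.
apply: eqm_sym; apply: eqm_trans; first exact: qpoch_eqm Qp0.
rewrite big_ord_recr /=.
rewrite -[X in eqm _ _ X]mulr1; apply: eqmM.
  by rewrite /qfac => i _; congr coefs; apply: eq_bigr => k _; rewrite exprS.
rewrite -exprS QpX -[X in eqm _ _ X]subr0; apply: eqmD => //.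
by move=> i iM; rewrite !coefsN (mono_eqm0 _ _ iM) //; nia.
Qed.

(** The Gaussian binomial with m + l above and m below, indexed symmetrically
    to avoid truncated subtractions. *)
Definition gauss m l := qfac (m + l) / (qfac m * qfac l).

Lemma gaussC m l : gauss m l = gauss l m.
Proof. by rewrite /gauss addnC mulrC [qfac m * _]mulrC mulrC. Qed.
Lemma gauss0 m : gauss m 0 = 1.
Proof. by rewrite /gauss addn0 qfac0 mulr1 divrr ?qfac_unit. Qed.
Lemma gaussK m l : gauss m l * (qfac m * qfac l) = qfac (m + l).
Proof. by rewrite /gauss divrK // unitrM !qfac_unit. Qed.

Lemma gaussS m l :
  gauss m.+1 l.+1 = gauss m.+1 l + Qp ^+ l.+1 * gauss m l.+1.
Proof.
have U : qfac m.+1 * qfac l.+1 \is a GRing.unit by rewrite unitrM !qfac_unit.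
apply: (mulIr U); rewrite gaussK mulrDl.
have -> : gauss m.+1 l * (qfac m.+1 * qfac l.+1)
  = (gauss m.+1 l * (qfac m.+1 * qfac l)) * (1 - Qp ^+ l.+1).
  by rewrite [qfac l.+1]qfacS !mulrA.
have -> : Qp ^+ l.+1 * gauss m l.+1 * (qfac m.+1 * qfac l.+1)
  = (gauss m l.+1 * (qfac m * qfac l.+1)) * (Qp ^+ l.+1 * (1 - Qp ^+ m.+1)).
  by rewrite [qfac m.+1]qfacS; ring.
rewrite !gaussK addnS addSn -addnS qfacS addnS.
rewrite (_ : (m + l).+2 = m.+1 + l.+1)%N; last by lia.
by rewrite exprD; ring.
Qed.

Lemma gaussSl m l :
  gauss m.+1 l.+1 = gauss m l.+1 + Qp ^+ m.+1 * gauss m.+1 l.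
Proof. by rewrite gaussC gaussS [gauss l.+1 _]gaussC [gauss l _]gaussC. Qed.

(** All Gaussian binomials far from the boundary share the limit
    1 / (Q; Q)_oo, which is why the coefficients of the triple product do not
    depend on the index of summation. *)
Lemma gauss_eqm M m l : (M <= m.+1)%N -> (M <= l.+1)%N ->
  eqm M (euler * gauss m l) 1.
Proof.
move=> Mm Ml; apply: (@eqmMr_inv _ _ _ _ euler euler_unit).
rewrite mul1r.
apply: (@eqm_trans _ _ _ (qfac m * gauss m l * qfac l)).
  apply: eqmM; first apply: eqmM => //.
    by apply: eqm_sym; apply: eqm_leq Mm (@qfac_eqm m).
  by apply: eqm_sym; apply: eqm_leq Ml (@qfac_eqm l).
rewrite mulrAC mulrC gaussK.
by apply: eqm_leq (@qfac_eqm (m + l)); lia.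
Qed.

End Gauss.

(** The triangular number n(n+1)/2 of an integer n; it is natural for negative
    n as well. *)
Definition tri (n : int) : nat :=
  match n with Posz k => 'C(k.+1, 2) | Negz k => 'C(k.+1, 2) end.

Lemma tri_int n : (tri n)%:Z * 2 = n * n + n.
Proof.
have bin2Z k : ('C(k.+1, 2))%:Z * 2 = k%:Z * (k%:Z + 1).
  have := bin2 k.+1; have := odd_double_half (k.+1 * k); rewrite oddM /= andNb.
  by rewrite -muln2 => + ->; lia.
by case: n => k; rewrite [tri _]/= bin2Z ?NegzE; lia.
Qed.

(** The exponent of q in the n-th term of the theta series at x = c q^a with
    p = a + b, that is p n(n-1)/2 + a n, in the symmetric form due to
    Ramanujan.  Both summands being natural, no negative power of q occurs for
    0 <= a <= p. *)
Definition thexp (a b : nat) (n : int) : nat := (a * tri n + b * tri (- n))%N.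

Lemma thexp_int a b n :
  (thexp a b n)%:Z * 2 = (a%:Z + b%:Z) * (n * n) + (a%:Z - b%:Z) * n.
Proof.
rewrite /thexp PoszD !PoszM mulrDl -!mulrA !tri_int; ring.
Qed.

Section ThetaTerm.
Variable R : comUnitRingType.
Variables (c : R) (a b p : nat).
Hypotheses (cU : c \is a GRing.unit) (p_gt0 : (0 < p)%N) (abp : (a + b)%N = p).

Definition thterm (n : int) : fps R := mono ((- c) ^ n) (thexp a b n).

Let ncU : - c \is a GRing.unit. Proof. by rewrite unitrN. Qed.

(** Multiplication by x Q^m moves the n-th term to the next one as long as
    n <= m, the condition for the remaining power Q^k to be integral; hence
    the finite products can be expanded by induction on the number of
    factors. *)
Lemma thterm_mulx (n : int) (m k : nat) : m%:Z = n + k%:Z ->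
  mono c a * Qp R p ^+ m * thterm n = - (Qp R p ^+ k * thterm (n + 1)).
Proof.
move=> mnk; rewrite !QpX !monoM -[RHS]mulN1r.
have -> : -1 = mono (-1) 0 :> fps R by apply: fpsP => -[|i] //=; rewrite oppr0.
rewrite monoM exprzDr // expr1z; congr mono; first by ring.
have := thexp_int a b n; have := thexp_int a b (n + 1); nia.
Qed.

Lemma thterm_mulz (n : int) (m k : nat) : m%:Z = k%:Z - n ->
  mono c^-1 b * Qp R p ^+ m * thterm n = - (Qp R p ^+ k * thterm (n - 1)).
Proof.
move=> mnk; rewrite !QpX !monoM -[RHS]mulN1r.
have -> : -1 = mono (-1) 0 :> fps R by apply: fpsP => -[|i] //=; rewrite oppr0.
rewrite monoM exprzDr // exprN1 invrN; congr mono; first by ring.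
have := thexp_int a b n; have := thexp_int a b (n - 1); nia.
Qed.

(** MacMahon's finite form of the triple product.  Adding a factor 1 - x Q^m,
    resp. 1 - Q^(l+1) / x, acts on the coefficients by one of the two Pascal
    rules for Gaussian binomials. *)
Lemma finite_triple_product m l :
  (\prod_(k < m) (1 - mono c a * Qp R p ^+ k)) *
  (\prod_(k < l) (1 - mono c^-1 b * Qp R p ^+ k)) =
  \sum_(j < (m + l).+1) gauss R p j (m + l - j) * thterm (j%:Z - l%:Z).
Proof.
elim: m => [|m IHm].
  rewrite big_ord0 mul1r add0n; elim: l => [|l IHl].
    rewrite big_ord0 big_ord1 subnn gauss0 // mul1r subrr /thterm expr0z.
    by rewrite /thexp /= !muln0 mono1.
  rewrite big_ord_recr /= IHl mulr_suml.
  under [LHS]eq_bigr => j _.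
    rewrite mulrBr mulr1 -[X in _ - X]mulrA [thterm _ * _]mulrC.
    rewrite (@thterm_mulz _ _ j); last by lia.
    rewrite mulrN opprK mulrA.
    rewrite (_ : j%:Z - l%:Z - 1 = j%:Z - l.+1%:Z); last by lia.
    rewrite (_ : j%:Z - l%:Z = j.+1%:Z - l.+1%:Z); last by lia.
    over.
  rewrite big_split /= addrC big_ord_recl [X in _ + X]big_ord_recr /=.
  rewrite addrA -[X in X + _]addrA -big_split.
  rewrite [RHS]big_ord_recl [X in _ = _ + X]big_ord_recr /=.
  rewrite addrA; congr (_ + _ + _).
  - by rewrite expr0 mulr1 !(gaussC _ _ 0) !gauss0.
  - apply: eq_bigr => i _; rewrite -mulrDl /bump add1n; congr (_ * _).
    have il := ltn_ord i.
    rewrite (_ : (l - i)%N = (l - i.+1).+1); last by lia.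
    rewrite (_ : (l.+1 - i.+1)%N = (l - i.+1).+1); last by lia.
    by rewrite gaussSl // addrC [X in _ + X]mulrC.
  - by rewrite /bump /= add1n !subnn !gauss0.
rewrite big_ord_recr /= mulrAC IHm mulr_suml.
under [LHS]eq_bigr => j _.
  rewrite mulrBr mulr1 -[X in _ - X]mulrA [thterm _ * _]mulrC.
  rewrite (@thterm_mulx _ _ (m + l - j)%N); last by case: j => j /= jlt; lia.
  rewrite mulrN opprK mulrA.
  rewrite (_ : j%:Z - l%:Z + 1 = j.+1%:Z - l%:Z); last by lia.
  over.
rewrite addSn big_split /= big_ord_recl [X in _ + X]big_ord_recr /=.
rewrite addrA -[X in X + _]addrA -big_split.
rewrite [RHS]big_ord_recl [X in _ = _ + X]big_ord_recr /=.
rewrite addrA; congr (_ + _ + _).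
- by rewrite !(gaussC _ _ 0) !gauss0.
- apply: eq_bigr => i _; rewrite -mulrDl /bump add1n; congr (_ * _).
  have iml := ltn_ord i.
  rewrite (_ : (m + l - i)%N = (m + l - i.+1).+1); last by lia.
  rewrite (_ : ((m + l).+1 - i.+1)%N = (m + l - i.+1).+1); last by lia.
  by rewrite gaussS // [X in _ = _ + X]mulrC.
- by rewrite /bump /= add1n !subnn !gauss0 // mulr1.
Qed.

End ThetaTerm.

(** * Bilateral series *)

(** Finite ranges stand for summation over all integers: two ranges give the
    same sum once both contain the support, so a bijection of the whole index
    types need not preserve them. *)
Lemma big_support_reindex (V : nmodType) (I J : eqType) (r : seq I) (s : seq J)
    (F : I -> V) (h : J -> I) (g : I -> J) :
  cancel h g -> cancel g h -> uniq r -> uniq s ->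
  (forall i, F i != 0 -> i \in r) -> (forall j, F (h j) != 0 -> j \in s) ->
  \sum_(i <- r) F i = \sum_(j <- s) F (h j).
Proof.
move=> hK gK ur us Fr Fs.
rewrite (bigID (fun i => F i != 0)) /= [X in _ + X]big1 ?addr0; last first.
  by move=> i; rewrite negbK => /eqP.
rewrite [RHS](bigID (fun j => F (h j) != 0)) /= [X in _ = _ + X]big1 ?addr0; last first.
  by move=> i; rewrite negbK => /eqP.
rewrite -big_filter -[RHS]big_filter -(big_map h predT F).
apply: perm_big; apply: uniq_perm; rewrite ?filter_uniq //.
  by rewrite map_inj_uniq ?filter_uniq //; apply: can_inj hK.
move=> i; rewrite mem_filter -[in RHS](gK i) mem_map; last exact: can_inj hK.
rewrite mem_filter gK; case: eqVneq => //= Fi.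
by rewrite Fr // Fs // gK.
Qed.

Definition zrange K : seq int := [seq i%:Z - K%:Z | i <- iota 0 K.*2.+1].

Lemma mem_zrange K n : (n \in zrange K) = (`|n| <= K)%N.
Proof.
apply/mapP/idP => [[i]|nK]; first by rewrite mem_iota => /andP[_ ilt] ->; lia.
by exists (absz (n + K%:Z)); rewrite ?mem_iota; lia.
Qed.

Lemma zrange_uniq K : uniq (zrange K).
Proof. by rewrite map_inj_uniq ?iota_uniq // => i j; lia. Qed.

Definition zbox K : seq (int * int) := [seq (n, n') | n <- zrange K, n' <- zrange K].

Lemma mem_zbox K x : (x \in zbox K) = (`|x.1| <= K)%N && (`|x.2| <= K)%N.
Proof.
rewrite -!mem_zrange; apply/allpairsP/andP => [[y [y1 y2 ->]]|[x1 x2]] //.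
by exists x; rewrite x1 x2; case: x {x1 x2}.
Qed.

Lemma zbox_uniq K : uniq (zbox K).
Proof. by rewrite allpairs_uniq ?zrange_uniq // => -[? ?] [? ?]. Qed.

(** A pair of integers is (s+d, s-d) or (s+d, s-d+1), according to the parity
    of the sum of its components, for unique s and d.  This diagonalises the
    quadratic form in the exponent of a product of two theta series. *)
Lemma big_zbox_parity (V : nmodType) (F : int * int -> V) K L :
  (2 * K < L)%N ->
  (forall x, F x != 0 -> (`|x.1| <= K)%N /\ (`|x.2| <= K)%N) ->
  \sum_(x <- zbox L) F x =
  \sum_(x <- zbox L) (F (x.1 + x.2, x.1 - x.2) + F (x.1 + x.2, x.1 - x.2 + 1)).
Proof.
move=> KL FK.
pose h (y : bool * (int * int)) := (y.2.1 + y.2.2, y.2.1 - y.2.2 + (y.1 : nat)%:Z).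
pose half (x : int * int) := ((x.1 + x.2) %/ 2)%Z.
pose g (x : int * int) := (((x.1 + x.2) %% 2)%Z == 1, (half x, x.1 - half x)).
have hK : cancel h g.
  by case=> b [s e]; rewrite /g /half /h /=; congr (_, (_, _)); case: b; lia.
have gK : cancel g h.
  case=> m n; rewrite /g /half /h /=; congr (_, _); first by lia.
  by case: eqP => /=; lia.
rewrite (big_support_reindex (h := h) (g := g)
  (s := [seq (b, x) | b <- [:: false; true], x <- zbox L])) ?zbox_uniq //.
- rewrite big_allpairs; move: (zbox L) => B; rewrite !big_cons big_nil /= addr0.
  rewrite -big_split /=.
  by apply: eq_bigr => x _; rewrite /h /= addr0.
- by rewrite allpairs_uniq ?zbox_uniq // => -[? ?] [? ?].
- by case=> m n /FK[/= x1 x2]; rewrite mem_zbox /=; apply/andP; split; lia.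
case=> b [s e] /FK[h1 h2]; apply/allpairsP; exists (b, (s, e)).
move: h1 h2 => /= h1 h2.
split=> //=; first by case: b {h1 h2}.
by rewrite mem_zbox /=; apply/andP; case: b h2 => /=; split; lia.
Qed.

Section Bilateral.
Variable R : comUnitRingType.
Implicit Types (w : int -> R) (e : int -> nat).

(** Exponents growing at least linearly, so that only |n| <= m+1 contributes to
    the coefficient of q^m. *)
Definition coercive e := forall n, (`|n| <= (e n).+1)%N.

Definition zser w e : fps R :=
  Fps (fun m => \sum_(n <- zrange m.+1) w n *+ (e n == m)).

Lemma coefs_zser w e K m : coercive e -> (m < K)%N ->
  coefs (zser w e) m = \sum_(n <- zrange K) w n *+ (e n == m).
Proof.
move=> ce mK /=; apply: (big_support_reindex (h := id) (g := id)) => //;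
  rewrite ?zrange_uniq // => n; rewrite mem_zrange; case: (e n =P m) => [en _|_];
  by rewrite ?eqxx // (leq_trans (ce n)) ?en.
Qed.

Lemma zserN w e : - zser w e = zser (fun n => - w n) e.
Proof.
apply: fpsP => m; rewrite coefsN /= -sumrN; apply: eq_bigr => n _.
by rewrite mulNrn.
Qed.

Lemma mono_zser c a w e : coercive e ->
  mono c a * zser w e = zser (fun n => c * w n) (fun n => a + e n)%N.
Proof.
move=> ce; have ce' : coercive (fun n => a + e n)%N.
  by move=> n; rewrite (leq_trans (ce n)) // ltnS leq_addl.
apply: fpsP => m; rewrite coefs_monoM [RHS](@coefs_zser _ _ m.+1) //.
case: leqP => am.
  rewrite (@coefs_zser _ _ m.+1) ?ltnS ?leq_subr // mulr_sumr.
  by apply: eq_bigr => n _; rewrite mulrnAr; congr (_ *+ _); lia.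
by rewrite big1 // => n _; rewrite (_ : (_ == _)%N = false) //; lia.
Qed.

Lemma coefs_zserM w w' e e' K m : coercive e -> coercive e' -> (m < K)%N ->
  coefs (zser w e * zser w' e') m =
  \sum_(x <- zbox K)
     w x.1 * w' x.2 *+ (e x.1 + e' x.2 == m)%N.
Proof.
move=> ce ce' mK; rewrite big_allpairs coefsM.
under [LHS]eq_bigr => i _.
  rewrite (@coefs_zser _ _ K) //; last by case: i => i /= ilt; lia.
  rewrite (@coefs_zser _ _ K) //; last by case: i => i /= ilt; lia.
  rewrite mulr_suml.
  under eq_bigr => n _ do rewrite mulr_sumr.
  over.
rewrite exchange_big /=; apply: eq_bigr => n _.
rewrite exchange_big /=; apply: eq_bigr => n' _.
under eq_bigr => i _ do rewrite mulrnAl mulrnAr -mulrnA mulnb.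
case: (leqP (e n) m) => enm; last first.
  rewrite big1 => [|i _]; last first.
    rewrite (_ : (_ && _) = false) //; case: i => i /= ilt; lia.
  rewrite (_ : (_ == _)%N = false) //; lia.
rewrite (bigD1 (Ordinal (enm : (e n < m.+1)%N))) //= eqxx big1 ?addr0.
  by congr (_ *+ _); lia.
move=> i /eqP ni; rewrite [X in _ && X](_ : _ = false) ?andbF //.
by apply/negbTE/eqP => eni; case: ni; apply/val_inj.
Qed.

End Bilateral.

(** * Theta functions and the three-term identity *)
Lemma absz_tri n : (`|n| <= (tri n).+1)%N.
Proof. by have := tri_int n; nia. Qed.

Lemma coercive_thexp a b : (0 < a + b)%N -> coercive (thexp a b).
Proof.
move=> ab n; rewrite /thexp; have := absz_tri n; have := absz_tri (- n); nia.
Qed.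

Lemma exprzMu (R : comUnitRingType) (x y : R) (n : int) :
  x \is a GRing.unit -> y \is a GRing.unit -> (x * y) ^ n = x ^ n * y ^ n.
Proof. by move=> xU yU; apply: exprMz_comm => //; apply: mulrC. Qed.

Lemma sq_absz (n : int) : (`|n| ^ 2)%N%:Z = n * n.
Proof. by rewrite -mulnn PoszM; lia. Qed.

Section Triple.
Variable R : comUnitRingType.
Variable p : nat.
Hypothesis p_gt0 : (0 < p)%N.
Implicit Types (c d : R) (a b : nat).

(** theta(x) at x = c q^a; the second parameter is Q/x. *)
Definition theta c a : fps R := qpoch2 (mono c a) (mono c^-1 (p - a)) (Qp R p).
Definition theta_series c a : fps R := zser (fun n => (- c) ^ n) (thexp a (p - a)).

(** The limit of [finite_triple_product]: the coefficient of q^i involves only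
    indices |n| <= i+1, for which the Gaussian binomial has reached its
    limit. *)
Lemma triple_product c a : c \is a GRing.unit -> (a <= p)%N ->
  euler R p * theta c a = theta_series c a.
Proof.
move=> cU ap; have abp : (a + (p - a) = p)%N by lia.
have ce : coercive (thexp a (p - a)) by apply: coercive_thexp; lia.
(* Indices |n| <= i+1 then lie at distance at least i+1 from -N and N. *)
apply: fpsP => i; pose N := (2 * i).+2.
have iN : (i < N)%N by rewrite /N; lia.
transitivity (coefs (\sum_(j < (N + N).+1)
    euler R p * (gauss R p j (N + N - j) * thterm c a (p - a) (j%:Z - N%:Z))) i).
  rewrite -mulr_sumr -finite_triple_product //; apply: (@eqmM _ N) iN => //.
  by apply: eqmM; apply: qpoch_eqm; apply: Qp0.
rewrite (coefs_zser _ ce iN) coefs_sum /zrange big_map -addnn.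
rewrite -[iota 0 _]/(index_iota 0 (N + N).+1) big_mkord.
apply: eq_bigr => -[j jlt] _; rewrite mulrA [nat_of_ord _]/=.
rewrite eq_sym -[RHS]/(coefs (thterm c a (p - a) (j%:Z - N%:Z)) i).
have [jN|jN] := leqP `|j%:Z - N%:Z| i.+1.
  rewrite -[in RHS](mul1r (thterm _ _ _ _)).
  apply: (@eqmM _ i.+1) => //; apply: gauss_eqm => //; rewrite /N in jN *; lia.
have T0 : eqm i.+1 (thterm c a (p - a) (j%:Z - N%:Z)) 0.
  by apply: mono_eqm0; have := ce (j%:Z - N%:Z); lia.
rewrite mulrC (eqmM T0 (@eqm_refl _ i.+1 _)) // mul0r.
by rewrite T0.
Qed.

(** The even and odd parts in x of the bilateral series obtained from
    [big_zbox_parity]: with x = c q^a these are sum_N Q^(N^2/4 - N/2) x^N over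
    the even N = 2s and, multiplied by Q^(1/4), over the odd N = 2s+1. *)
Definition evenser c a : fps R :=
  zser (fun s => c ^ (2 * s)%R) (fun s => 2 * thexp a (p - a) s)%N.
Definition oddser c a : fps R :=
  zser (fun s => c ^ (2 * s + 1)%R)
       (fun s => a * absz (s + 1)%R ^ 2 + (p - a) * `|s| ^ 2)%N.

(** The product x theta(xy) theta(y/x) as a determinant: the terms of index
    (s+e, s-e) separate into an even power of y and an odd power of x, those of
    index (s+e, s-e+1) into an odd power of y and an even power of x, with the
    opposite sign.  The conditions on a and b make all exponents of q
    natural. *)
Lemma theta_series_mul c d a b : c \is a GRing.unit -> d \is a GRing.unit ->
  (a <= b)%N -> (a + b <= p)%N ->
  mono c a * theta_series (c * d) (a + b) * theta_series (d / c) (b - a) =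
  evenser d b * oddser c a - oddser d b * evenser c a.
Proof.
move=> cU dU ab abp.
have ce x : (x <= p)%N -> coercive (thexp x (p - x)).
  by move=> xp; apply: coercive_thexp; lia.
have co x : (x <= p)%N ->
    coercive (fun s => x * absz (s + 1)%R ^ 2 + (p - x) * `|s| ^ 2)%N.
  by move=> xp n; nia.
have ce2 x : (x <= p)%N -> coercive (fun s => 2 * thexp x (p - x) s)%N.
  by move=> xp n; apply: leq_trans (ce _ xp n) _; lia.
have ceJ : coercive (fun n => a + thexp (a + b) (p - (a + b)) n)%N.
  by move=> n; apply: leq_trans (ce _ abp n) _; lia.
have ba : (b - a <= p)%N by lia.
have ap : (a <= p)%N by lia.
have bp : (b <= p)%N by lia.
apply: fpsP => m; pose L := (2 * m.+1).+1; have mL : (m < L)%N by rewrite /L; lia.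
rewrite /theta_series mono_zser; last exact: ce.
rewrite -[- (oddser _ _ * _)]mulNr [- oddser _ _]zserN coefsD.
rewrite (coefs_zserM _ _ ceJ (ce _ ba) mL) (coefs_zserM _ _ (ce2 _ bp) (co _ ap) mL).
rewrite (coefs_zserM _ _ (co _ bp) (ce2 _ ap) mL).
rewrite (@big_zbox_parity _ _ m.+1) //; last first.
  case=> n n' /=; case: (_ =P m); last by rewrite mulr0n eqxx.
  by move=> nn' _; have := ceJ n; have := ce _ ba n'; lia.
rewrite -big_split /=; apply: eq_bigr => -[s e] _ /=.
have cdU : - (c * d) \is a GRing.unit by rewrite unitrN unitrM cU.
have dcU : - (d / c) \is a GRing.unit by rewrite unitrN unitrM dU unitrV.
have wt : (- (c * d)) ^ (s + e) * (- (d / c)) ^ (s - e) = d ^ (2 * s)%R * c ^ (2 * e)%R.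
  rewrite !exprzDr // -exprz_inv mulrACA -!exprzMu ?unitrV //.
  rewrite -!exprz_exp; congr (_ ^ _ * _ ^ _).
    by rewrite mulrNN mulrCA [c * d]mulrC mulrK // -expr2.
  by rewrite invrN mulrNN invrM ?unitrV // invrK mulrCA mulrK // -expr2.
rewrite [_ ^ (s - e + 1)]exprzDr //.
congr (_ + _).
- rewrite -mulrA wt exprzDr // expr1z; congr (_ *+ _); first by ring.
  congr nat_of_bool; congr (_ == m).
  have := thexp_int (a + b) (p - (a + b)) (s + e).
  have := thexp_int (b - a) (p - (b - a)) (s - e).
  have := thexp_int b (p - b) s.
  have [r pE] : {r | p = a + b + r}%N by exists (p - (a + b))%N; lia.
  have [k bE] : {k | b = a + k}%N by exists (b - a)%N; lia.
  rewrite pE bE.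
  rewrite (_ : a + (a + k) + r - (a + (a + k)) = r)%N; last by lia.
  rewrite (_ : a + k - a = k)%N; last by lia.
  rewrite (_ : a + (a + k) + r - k = a + a + r)%N; last by lia.
  rewrite (_ : a + (a + k) + r - (a + k) = a + r)%N; last by lia.
  rewrite (_ : a + (a + k) + r - a = a + k + r)%N; last by lia.
  move: (sq_absz (e + 1)%R) (sq_absz e).
  set u := (absz _ ^ 2)%N; set v := (absz _ ^ 2)%N.
  by rewrite -/v; lia.
rewrite expr1z mulrA -[c * _ * _]mulrA wt exprzDr // expr1z; congr (_ *+ _).
  rewrite mulrN mulNr; congr (- _).
  transitivity (d ^ (2 * s)%R * d * c ^ (2 * e)%R * (c / c)); first by ring.
  by rewrite divrr // mulr1.
congr nat_of_bool; congr (_ == m).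
have := thexp_int (a + b) (p - (a + b)) (s + e).
have := thexp_int (b - a) (p - (b - a)) (s - e + 1).
have := thexp_int a (p - a) e.
have [r pE] : {r | p = a + b + r}%N by exists (p - (a + b))%N; lia.
have [k bE] : {k | b = a + k}%N by exists (b - a)%N; lia.
rewrite pE bE.
rewrite (_ : a + (a + k) + r - (a + (a + k)) = r)%N; last by lia.
rewrite (_ : a + k - a = k)%N; last by lia.
rewrite (_ : a + (a + k) + r - k = a + a + r)%N; last by lia.
rewrite (_ : a + (a + k) + r - (a + k) = a + r)%N; last by lia.
rewrite (_ : a + (a + k) + r - a = a + k + r)%N; last by lia.
move: (sq_absz (s + 1)%R) (sq_absz s).
set u := (absz _ ^ 2)%N; set v := (absz _ ^ 2)%N.
by rewrite -/v; lia.
Qed.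

End Triple.

Section ThreeTerm.
Variable R : comUnitRingType.
Variable p : nat.
Hypothesis p_gt0 : (0 < p)%N.
Implicit Types (c d u : R) (a b : nat).
Local Notation theta := (theta p).

(** The Pluecker relation [1u][xy] - [1x][uy] + [1y][ux] = 0 between the
    determinants [xy] of [theta_series_mul], where 1 and u have exponent 0. *)
Lemma theta_three_term u c d a b : u \is a GRing.unit -> c \is a GRing.unit ->
  d \is a GRing.unit -> (a <= b)%N -> (a + b <= p)%N ->
  theta u 0 ^+ 2 * (mono c a * theta (c * d) (a + b) * theta (d / c) (b - a)) =
  mono u 0 * (theta c a ^+ 2 * (theta (u * d) b * theta (d / u) b)
              - theta d b ^+ 2 * (theta (u * c) a * theta (c / u) a)).
Proof.
move=> uU cU dU ab abp.
have ap : (a <= p)%N by lia.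
have bp : (b <= p)%N by lia.
have det := @theta_series_mul R p p_gt0.
have H1 := det 1 u 0 0 (unitr1 _) uU isT isT.
have H2 := det 1 c 0 a (unitr1 _) cU isT ap.
have H3 := det 1 d 0 b (unitr1 _) dU isT bp.
have H4 := det u d 0 b uU dU isT bp.
have H5 := det u c 0 a uU cU isT ap.
have H6 := det c d a b cU dU ab abp.
move: H1 H2 H3 H4 H5 H6; rewrite mono1 !mul1r !divr1 !add0n !subn0 => H1 H2 H3 H4 H5 H6.
have tp := @triple_product R p p_gt0.
have E4 : euler R p ^+ 4 \is a GRing.unit by rewrite unitrX // euler_unit.
apply: (mulrI E4).
rewrite -!tp ?unitrM ?unitrV ?uU ?cU ?dU // in H1 H2 H3 H4 H5 H6; try lia.
move: H1 H2 H3 H4 H5 H6.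
set E := euler R p; set tu := theta u 0; set tc := theta c a; set td := theta d b.
set tud := theta (u * d) b; set tdu := theta (d / u) b.
set tuc := theta (u * c) a; set tcu := theta (c / u) a.
set tcd := theta (c * d) _; set tdc := theta (d / c) _.
set mc := mono c a; set mu := mono u 0.
move=> H1 H2 H3 H4 H5 H6.
transitivity ((E * tu * (E * tu)) * (mc * (E * tcd) * (E * tdc))); first by ring.
rewrite H1 H6.
transitivity ((E * tc * (E * tc)) * (mu * (E * tud) * (E * tdu))
   - (E * td * (E * td)) * (mu * (E * tuc) * (E * tcu))); last by ring.
rewrite H2 H3 H4 H5; ring.
Qed.

End ThreeTerm.

(** * Lambert series and the Weierstrass function *)
Section Lambert.
Variable R : comUnitRingType.
Implicit Types (c : R) (e : nat).

(** The sum over m of m X^m for X = c q^e, in closed form. *)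
Definition lambert c e : fps R := mono c e / (1 - mono c e) ^+ 2.

Lemma coefs_mono0 c e : (0 < e)%N -> coefs (mono c e) 0 = 0.
Proof. by case: e. Qed.

Lemma lambertK c e : (0 < e)%N -> (1 - mono c e) ^+ 2 * lambert c e = mono c e.
Proof.
by move=> e0; rewrite mulrC divrK // unitrX // one_sub_unit // coefs_mono0.
Qed.

Lemma sum_mulrn_expr (S : comNzRingType) (x : S) N :
  (1 - x) ^+ 2 * (\sum_(m < N) m%:R * x ^+ m) = x + (N%:R * (x - 1) - x) * x ^+ N.
Proof.
elim: N => [|N IH]; first by rewrite big_ord0 expr0 mulr0 mul0r sub0r mulr1 subrr.
by rewrite big_ord_recr /= mulrDr IH [x ^+ N.+1]exprS -[N.+1%:R]natr1; ring.
Qed.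

Lemma lambert_eqm c e N : (0 < e)%N ->
  eqm N (lambert c e) (\sum_(m < N) m%:R * mono c e ^+ m).
Proof.
move=> e0; have U : (1 - mono c e) ^+ 2 \is a GRing.unit.
  by rewrite unitrX // one_sub_unit // coefs_mono0.
apply: (eqmMr_inv U); rewrite ![_ * (1 - _) ^+ 2]mulrC lambertK // sum_mulrn_expr.
rewrite monoX mulrC -[X in eqm _ X]addr0; apply: eqmD => //.
by apply/eqm_sym/eqm_monoM0; nia.
Qed.

Lemma coefsMn (f : fps R) m n : coefs (f *+ m) n = coefs f n *+ m.
Proof. by elim: m => // m IH; rewrite !mulrS coefsD IH. Qed.

Lemma coefs_lambert c e N n : (0 < e)%N -> (n < N)%N ->
  coefs (lambert c e) n = \sum_(m < N) m%:R * c ^+ m *+ (n == m * e)%N.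
Proof.
move=> e0 nN; rewrite (lambert_eqm c e0 nN) coefs_sum; apply: eq_bigr => m _.
by rewrite monoX mulr_natl coefsMn mulrnAC mulr_natl.
Qed.

End Lambert.

Section Weierstrass.
Variable R : comUnitRingType.
Variable p : nat.
Hypothesis p_gt0 : (0 < p)%N.
Implicit Types (c : R) (a e : nat).

(** The Weierstrass function at x = c q^a, up to a constant factor and an
    additive constant.  The summand of index k is divisible by q^k, so the
    truncation does not affect the coefficient of q^n. *)
Definition wp c a : fps R :=
  Fps (fun n => coefs (\sum_(k < n.+1)
    (lambert c (a + k * p) + lambert c^-1 (p - a + k * p))) n).

Lemma lambert_eqm0 c e N : (N <= e)%N -> eqm N (lambert c e) 0.
Proof. by move=> Ne; apply: eqm_monoM0. Qed.

Lemma wp_eqm c a N :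
  eqm N (wp c a) (\sum_(k < N) (lambert c (a + k * p) + lambert c^-1 (p - a + k * p))).
Proof.
move=> n; elim: N => // N IH; rewrite ltnS leq_eqVlt => /orP[/eqP->//|nN].
rewrite IH // big_ord_recr [X in _ = coefs X _]/= coefsD.
rewrite [X in _ + X](_ : _ = 0) ?addr0 // coefsD.
by rewrite !(@lambert_eqm0 _ _ n.+1) ?addr0 //; nia.
Qed.

End Weierstrass.

(** * Deformation in a second indeterminate *)
Section MonoLinear.
Variable R : comUnitRingType.
Lemma monoD (c d : R) e : mono (c + d) e = mono c e + mono d e.
Proof. by apply: fpsP => n /=; rewrite mulrnDl. Qed.
Lemma monoN (c : R) e : mono (- c) e = - mono c e.
Proof. by apply: fpsP => n /=; rewrite mulNrn. Qed.
End MonoLinear.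

Section Jets.
Variable R : comUnitRingType.
Implicit Types (f g : fps (fps R)) (c : R) (v : fps R).

(** The inner series are in t, the outer one in q: this is the coefficient of
    t^k, a series in q. *)
Definition tcoef k f : fps R := Fps (fun n => coefs (coefs f n) k).

Lemma tcoefB k f g : tcoef k (f - g) = tcoef k f - tcoef k g.
Proof. exact: fpsP. Qed.

Lemma tcoefM k f g :
  tcoef k (f * g) = \sum_(i < k.+1) tcoef i f * tcoef (k - i) g.
Proof.
apply: fpsP => n; rewrite coefs_sum [LHS]/= coefs_sum.
under eq_bigr => i _ do rewrite coefsM.
by rewrite exchange_big.
Qed.

Lemma tcoefM0 f g : tcoef 0 (f * g) = tcoef 0 f * tcoef 0 g.
Proof. by rewrite tcoefM big_ord1. Qed.
Lemma tcoefM1 f g : tcoef 1 (f * g) = tcoef 0 f * tcoef 1 g + tcoef 1 f * tcoef 0 g.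
Proof. by rewrite tcoefM !big_ord_recl big_ord0 addr0. Qed.
Lemma tcoefM2 f g : tcoef 2 (f * g) =
  tcoef 0 f * tcoef 2 g + tcoef 1 f * tcoef 1 g + tcoef 2 f * tcoef 0 g.
Proof. by rewrite tcoefM !big_ord_recl big_ord0 addr0 /= addrA. Qed.

Lemma tcoef_mono k v e : tcoef k (mono v e) = mono (coefs v k) e.
Proof. by apply: fpsP => n /=; rewrite coefsMn. Qed.

Lemma tcoef1 k : tcoef k 1 = (k == 0)%:R.
Proof.
by rewrite -mono1 tcoef_mono coefs1; apply: fpsP => -[|n]; case: k.
Qed.

Lemma tcoef_monoM k f : tcoef k (mono (mono 1 k) 0 * f) = tcoef 0 f.
Proof.
apply: fpsP => n.
change (coefs (coefs (mono (mono 1 k) 0 * f) n) k = coefs (coefs f n) 0).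
by rewrite coefs_monoM subn0 coefs_monoM leqnn subnn mul1r.
Qed.

Lemma eqm_tcoef k M f g : eqm M f g -> eqm M (tcoef k f) (tcoef k g).
Proof. by move=> fg i iM /=; rewrite fg. Qed.

(** f = f0 (1 + t^2 r) modulo t^3 and q^M.  Factoring out f0 makes r additive
    under products, like a second logarithmic derivative. *)
Definition jet2 M f (f0 r : fps R) :=
  [/\ eqm M (tcoef 0 f) f0, eqm M (tcoef 1 f) 0 & eqm M (tcoef 2 f) (f0 * r)].

Lemma jet2M M f g (f0 g0 r s : fps R) : jet2 M f f0 r -> jet2 M g g0 s ->
  jet2 M (f * g) (f0 * g0) (r + s).
Proof.
case=> f1 f2 f3 [g1 g2 g3]; rewrite /jet2 tcoefM0 tcoefM1 tcoefM2; split.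
- exact: eqmM.
- have -> : 0 = f0 * 0 + 0 * g0 by rewrite mulr0 mul0r addr0.
  by apply: eqmD; apply: eqmM.
- have -> : f0 * g0 * (r + s) = f0 * (g0 * s) + 0 * 0 + (f0 * r) * g0 by ring.
  by apply: eqmD; [apply: eqmD|]; apply: eqmM.
Qed.

Lemma jet2_one M : jet2 M 1 1 0.
Proof. by rewrite /jet2 !tcoef1 mulr0. Qed.

Lemma jet2_prod M N (F : nat -> fps (fps R)) (F0 r : nat -> fps R) :
  (forall k, jet2 M (F k) (F0 k) (r k)) ->
  jet2 M (\prod_(k < N) F k) (\prod_(k < N) F0 k) (\sum_(k < N) r k).
Proof.
move=> FF; elim: N => [|N IH]; first by rewrite !big_ord0; apply: jet2_one.
by rewrite !big_ord_recr; apply: jet2M.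
Qed.

Lemma jet2_eqm M f f' (f0 f0' r r' : fps R) :
  eqm M f f' -> eqm M f0 f0' -> eqm M r r' ->
  jet2 M f' f0' r' -> jet2 M f f0 r.
Proof.
move=> ff f00 rr [h0 h1 h2]; split.
- by apply: eqm_trans (eqm_sym f00); apply: eqm_trans h0; apply: eqm_tcoef.
- by apply: eqm_trans h1; apply: eqm_tcoef.
- apply: eqm_trans (eqm_sym (eqmM f00 rr)).
  by apply: eqm_trans h2; apply: eqm_tcoef.
Qed.

Lemma mono0 e : mono 0 e = 0 :> fps R.
Proof. by apply: fpsP => n /=; rewrite mul0rn. Qed.

Lemma jet2_const M c e : jet2 M (1 - mono (mono c 0) e) (1 - mono c e) 0.
Proof.
by rewrite /jet2 !tcoefB !tcoef1 !tcoef_mono /= !mono0 mulr0 !subr0.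
Qed.

Definition one_plus_t : fps R := 1 + mono 1 1.

Lemma one_plus_t_unit : one_plus_t \is a GRing.unit.
Proof. by rewrite fps_unitE coefsD /= addr0 unitr1. Qed.

Lemma one_plus_t_sub1 : one_plus_t - 1 = mono 1 1.
Proof. by rewrite addrAC subrr add0r. Qed.

Lemma one_plus_t0 : coefs one_plus_t 0 = 1. Proof. by rewrite coefsD /= addr0. Qed.

Lemma coefs_inv0 v : coefs v 0 \is a GRing.unit -> coefs v^-1 0 = (coefs v 0)^-1.
Proof.
move=> v0; have := congr1 (fun h : fps R => coefs h 0%N)
  (mulrV (v0 : v \is a GRing.unit)).
by rewrite /= big_ord1 subnn => vv; rewrite -[LHS](mulKr v0) vv mulr1.
Qed.

Lemma mono0_unit c : c \is a GRing.unit -> mono c 0 \is a GRing.unit.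
Proof. by rewrite fps_unitE /= mulr1n. Qed.

Lemma mono0V c : c \is a GRing.unit -> (mono c 0)^-1 = mono c^-1 0.
Proof.
move=> cU; apply: (mulrI (mono0_unit cU)); rewrite mulrV ?mono0_unit //.
by rewrite monoM mulrV // mono1.
Qed.

(** Here (1 - uX)(1 - X/u) = (1 - X)^2 - (u + 1/u - 2) X for u = 1 + t, and
    u + 1/u - 2 = t^2 / u starts with t^2. *)
Lemma jet2_pair M c e : (0 < e)%N ->
  jet2 M ((1 - mono (one_plus_t * mono c 0) e) * (1 - mono (mono c 0 / one_plus_t) e))
         ((1 - mono c e) ^+ 2) (- lambert c e).
Proof.
move=> e0; set u := one_plus_t.
have uU : u \is a GRing.unit := one_plus_t_unit.
pose X := mono (mono c 0) e; pose w := mono 1 2 * u^-1.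
have -> : (1 - mono (u * mono c 0) e) * (1 - mono (mono c 0 / u) e)
  = (1 - X) ^+ 2 - mono (w * mono c 0) e.
  have -> : mono (u * mono c 0) e = mono u 0 * X by rewrite monoM.
  have -> : mono (mono c 0 / u) e = mono u^-1 0 * X by rewrite monoM mulrC.
  have -> : mono (w * mono c 0) e = mono w 0 * X by rewrite monoM.
  have -> : mono w 0 = mono u 0 + mono u^-1 0 - 2%:R.
    have -> : w = u + u^-1 - 2%:R.
      rewrite /w (_ : mono 1 2 = (u - 1) ^+ 2).
        transitivity (u * (u * u^-1) - 2%:R * (u * u^-1) + u^-1); first by ring.
        by rewrite mulrV //; ring.
      by rewrite /u /one_plus_t addrC addKr expr2 monoM mulr1.
    by rewrite -[2%:R in LHS]/(1 + 1) -[2%:R in RHS]/(1 + 1) !(monoD, monoN) mono1.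
  have UV : mono u 0 * mono u^-1 0 = 1 by rewrite monoM mulrV // mono1.
  transitivity (1 - (mono u 0 + mono u^-1 0) * X + (mono u 0 * mono u^-1 0) * (X * X)).
    by ring.
  by rewrite UV; ring.
have [j0 j1 j2] := jet2M (jet2_const M c e) (jet2_const M c e).
rewrite -/X -expr2 in j0 j1 j2.
have W0 : coefs (w * mono c 0) 0 = 0 by rewrite /w -mulrA coefs_monoM.
have W1 : coefs (w * mono c 0) 1 = 0 by rewrite /w -mulrA coefs_monoM.
have W2 : coefs (w * mono c 0) 2 = c.
  rewrite /w -mulrA coefs_monoM mul1r subnn coefsM0 coefs_inv0 one_plus_t0 ?unitr1 //.
  by rewrite invr1 mul1r.
rewrite /jet2 !tcoefB !tcoef_mono W0 W1 W2 !mono0 !subr0; split=> //.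
rewrite mulrN lambertK // -[X in eqm _ _ X]add0r; apply: eqmD => //.
by move: j2; rewrite addr0 mulr0.
Qed.

End Jets.

Section ThetaProducts.
Variable R : comUnitRingType.
Variable p : nat.
Hypothesis p_gt0 : (0 < p)%N.
Implicit Types (c : R) (a e : nat).

Lemma qpoch_mono_eqm c e N :
  eqm N (qpoch (mono c e) (Qp R p)) (\prod_(k < N) (1 - mono c (e + k * p))).
Proof.
apply: eqm_trans; first by apply: qpoch_eqm; apply: Qp0.
by move=> i _; congr coefs; apply: eq_bigr => k _; rewrite QpX monoM mulr1.
Qed.

Lemma theta_eqm c a N : eqm N (theta p c a)
  (\prod_(k < N) ((1 - mono c (a + k * p)) * (1 - mono c^-1 (p - a + k * p)))).
Proof. by rewrite big_split; apply: eqmM; apply: qpoch_mono_eqm. Qed.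

Lemma qpoch_mono_shift c e :
  qpoch (mono c e) (Qp R p) = (1 - mono c e) * qpoch (mono c (e + p)) (Qp R p).
Proof.
apply: eqm_all => M; apply: (@eqm_leq _ M M.+1) => //.
apply: eqm_trans; first exact: qpoch_mono_eqm.
apply: eqm_sym; apply: eqm_trans.
  by apply: eqmM; [exact: eqm_refl | exact: qpoch_mono_eqm].
rewrite [in X in eqm _ _ X]big_ord_recl big_ord_recr /= mul0n addn0.
apply: eqmM => //; rewrite -[X in eqm _ _ X]mulr1; apply: eqmM.
  by move=> i _; congr coefs; apply: eq_bigr => k _; rewrite /bump /= add1n mulSn addnA.
rewrite -[X in eqm _ _ X]subr0; apply: eqmD => // i iM.
by rewrite !coefsN (mono_eqm0 _ _ iM) //; nia.
Qed.

(** theta(x) / (1 - x) for x of exponent 0, where theta has its zero. *)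
Definition theta1 c : fps R := qpoch (mono c p) (Qp R p) * qpoch (mono c^-1 p) (Qp R p).

Lemma theta_at0 c : theta p c 0 = (1 - mono c 0) * theta1 c.
Proof. by rewrite /theta /qpoch2 qpoch_mono_shift add0n subn0 mulrA. Qed.

Lemma theta1_1 : theta1 1 = euler R p ^+ 2.
Proof. by rewrite /theta1 invr1. Qed.

Lemma theta_unit c a : (0 < a < p)%N -> theta p c a \is a GRing.unit.
Proof.
move=> ap; rewrite unitrM !qpoch_unit //; apply: coefs_mono0; lia.
Qed.

Lemma thetaE c a :
  theta p c a = qpoch (mono c a) (Qp R p) * qpoch (mono c^-1 (p - a)) (Qp R p).
Proof. by []. Qed.
Lemma theta1E c :
  theta1 c = qpoch (mono c p) (Qp R p) * qpoch (mono c^-1 p) (Qp R p).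
Proof. by []. Qed.

(** The three-term identity with the double zero at u = 1 made explicit. *)
Lemma theta_three_term_deform u c d a b : u \is a GRing.unit -> c \is a GRing.unit ->
  d \is a GRing.unit -> (a <= b)%N -> (a + b <= p)%N ->
  theta p c a ^+ 2 * (theta p (u * d) b * theta p (d / u) b)
    - theta p d b ^+ 2 * (theta p (u * c) a * theta p (c / u) a) =
  mono ((1 - u) ^+ 2) 0 *
    (mono u^-1 0 * theta1 u ^+ 2 *
     (mono c a * theta p (c * d) (a + b) * theta p (d / c) (b - a))).
Proof.
move=> uU cU dU ab abp.
have UV : mono u^-1 0 * mono u 0 = 1 by rewrite monoM mulVr // mono1.
rewrite -[LHS]mul1r -UV -mulrA -(theta_three_term p_gt0) // theta_at0.
have -> : mono ((1 - u) ^+ 2) 0 = (1 - mono u 0) ^+ 2.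
  by rewrite -[X in _ = (X - _) ^+ 2](mono1 R) -monoN -monoD monoX muln0.
by ring.
Qed.

End ThetaProducts.

Section JetTheta.
Variable R : comUnitRingType.
Variable p : nat.
Hypothesis p_gt0 : (0 < p)%N.
Implicit Types (c d : R) (a b e : nat) (v : fps R).

Local Notation u := (one_plus_t R).

Lemma tcoef0_qpoch v e :
  tcoef 0 (qpoch (mono v e) (Qp _ p)) = qpoch (mono (coefs v 0) e) (Qp R p).
Proof.
apply: eqm_all => M; apply: eqm_trans.
  by apply: eqm_tcoef; apply: qpoch_mono_eqm.
apply: eqm_sym; apply: eqm_trans; first exact: qpoch_mono_eqm.
rewrite (big_morph _ (@tcoefM0 R) (tcoef1 R 0)).
by move=> i _; congr coefs; apply: eq_bigr => k _; rewrite tcoefB tcoef1 tcoef_mono.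
Qed.

Lemma tcoef0_theta v a : coefs v 0 \is a GRing.unit ->
  tcoef 0 (theta p v a) = theta p (coefs v 0) a.
Proof.
move=> vU; rewrite !thetaE tcoefM0 -(coefs_inv0 vU).
by congr (_ * _); apply: tcoef0_qpoch.
Qed.

Lemma tcoef0_theta1 v : coefs v 0 \is a GRing.unit ->
  tcoef 0 (theta1 p v) = theta1 p (coefs v 0).
Proof.
move=> vU; rewrite !theta1E tcoefM0 -(coefs_inv0 vU).
by congr (_ * _); apply: tcoef0_qpoch.
Qed.

Lemma jet2_theta_const M c a : c \is a GRing.unit ->
  jet2 M (theta p (mono c 0) a) (theta p c a) 0.
Proof.
move=> cU; apply: jet2_eqm; [exact: theta_eqm | exact: theta_eqm | | ].
  exact: (@eqm_refl _ M 0).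
rewrite mono0V //.
have -> : 0 = \sum_(k < M) (0 + 0) :> fps R by rewrite big1 // => k _; rewrite addr0.
pose F k := (1 - mono (mono c 0) (a + k * p)) * (1 - mono (mono c^-1 0) (p - a + k * p)).
pose F0 k := (1 - mono c (a + k * p)) * (1 - mono c^-1 (p - a + k * p)).
apply: (@jet2_prod _ M M F F0 (fun=> 0 + 0)) => k.
by apply: jet2M; apply: jet2_const.
Qed.

(** Second-order deformation of theta(x)^2: the logarithmic derivatives of the
    factors add up to the Lambert series of wp. *)
Lemma jet2_theta_pair M c a : c \is a GRing.unit -> (0 < a < p)%N ->
  jet2 M (theta p (u * mono c 0) a * theta p (mono c 0 / u) a)
         (theta p c a ^+ 2) (- wp p c a).
Proof.
move=> cU /andP[a0 ap].
pose F k :=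
  ((1 - mono (u * mono c 0) (a + k * p)) *
   (1 - mono (mono c 0 / u) (a + k * p))) *
  ((1 - mono (u * mono c^-1 0) (p - a + k * p)) *
   (1 - mono (mono c^-1 0 / u) (p - a + k * p))).
pose F0 k := (1 - mono c (a + k * p)) ^+ 2 * (1 - mono c^-1 (p - a + k * p)) ^+ 2.
pose r k := - lambert c (a + k * p) + - lambert c^-1 (p - a + k * p).
apply: (@jet2_eqm _ _ _ (\prod_(k < M) F k) _ (\prod_(k < M) F0 k) _
  (\sum_(k < M) r k)).
- apply: eqm_trans; first by apply: eqmM; apply: theta_eqm.
  rewrite -big_split => i _; congr coefs; apply: eq_bigr => k _.
  rewrite !invrM ?unitrV ?one_plus_t_unit ?mono0_unit // invrK mono0V // [_ / u]mulrC.
  by rewrite /F [_ / u]mulrC [X in _ = _ * (_ * (1 - mono X _))]mulrC /=; ring.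
- apply: eqm_trans; first by rewrite expr2; apply: eqmM; apply: theta_eqm.
  rewrite -big_split => i _; congr coefs; apply: eq_bigr => k _.
  by rewrite /F0 /=; ring.
- have -> : \sum_(k < M) r k =
     - \sum_(k < M) (lambert c (a + k * p) + lambert c^-1 (p - a + k * p)).
    by rewrite -sumrN; apply: eq_bigr => k _; rewrite /r opprD.
  by move=> i iM; rewrite !coefsN (wp_eqm _ _ _ iM).
by apply: jet2_prod => k; apply: jet2M; apply: jet2_pair; lia.
Qed.

(** The coefficient of t^2 in an identity of the shape of
    [theta_three_term_deform], for arbitrary series.  The terms independent of
    t cancel on the left-hand side. *)
Lemma tcoef2_three_term (A B Kd Kc T X G1 G2 : fps (fps R))
    (v A0 B0 t x g1 g2 r s : fps R) :
  A ^+ 2 * Kd - B ^+ 2 * Kc =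
    mono (mono 1 2) 0 * (mono v 0 * T ^+ 2 * (X * G1 * G2)) ->
  coefs v 0 = 1 -> tcoef 0 T = t -> tcoef 0 X = x ->
  tcoef 0 G1 = g1 -> tcoef 0 G2 = g2 ->
  (forall M, jet2 M A A0 0) -> (forall M, jet2 M B B0 0) ->
  (forall M, jet2 M Kd (B0 ^+ 2) (- s)) -> (forall M, jet2 M Kc (A0 ^+ 2) (- r)) ->
  (r - s) * (A0 ^+ 2 * B0 ^+ 2) = t ^+ 2 * (x * g1 * g2).
Proof.
move=> E v0 <- <- <- <- jA jB jd jc.
have := congr1 (tcoef 2) E.
rewrite tcoef_monoM !expr2 !tcoefM0 tcoef_mono v0 mono1 mul1r => <-.
apply: eqm_all => M; rewrite tcoefB.
have [_ _ j1] := jet2M (jet2M (jA M) (jA M)) (jd M).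
have [_ _ j2] := jet2M (jet2M (jB M) (jB M)) (jc M).
have -> : (r - s) * (A0 * A0 * (B0 * B0)) =
   A0 * A0 * B0 ^+ 2 * (0 + 0 + - s) - B0 * B0 * A0 ^+ 2 * (0 + 0 + - r) by ring.
by apply: eqm_sym; apply: eqmD => // k kM; rewrite !coefsN j2.
Qed.

(** The addition formula
    wp(x) - wp(y) = - sigma(x+y) sigma(x-y) / (sigma(x)^2 sigma(y)^2)
    in multiplicative notation: the coefficient of (u - 1)^2 in the three-term
    identity. *)
Theorem wp_sub c d a b : c \is a GRing.unit -> d \is a GRing.unit ->
  (0 < a)%N -> (a <= b < p)%N -> (a + b <= p)%N ->
  (wp p c a - wp p d b) * (theta p c a ^+ 2 * theta p d b ^+ 2) =
  euler R p ^+ 4 * (mono c a * theta p (c * d) (a + b) * theta p (d / c) (b - a)).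
Proof.
move=> cU dU a0 /andP[ab bp] abp.
have uU : u \is a GRing.unit := one_plus_t_unit R.
have E := theta_three_term_deform p_gt0 uU (mono0_unit cU) (mono0_unit dU) ab abp.
have u2 : (1 - u) ^+ 2 = mono 1 2.
  by rewrite -opprB sqrrN one_plus_t_sub1 monoX expr1n.
rewrite {}u2 in E.
have u0U : coefs u 0 \is a GRing.unit by rewrite one_plus_t0 unitr1.
have v0 : coefs u^-1 0 = 1 by rewrite (coefs_inv0 u0U) one_plus_t0 invr1.
have T0 : tcoef 0 (theta1 p u) = euler R p ^+ 2.
  by rewrite (tcoef0_theta1 u0U) one_plus_t0 theta1_1.
have cd0 : coefs (mono c 0 * mono d 0) 0 = c * d by rewrite monoM.
have dc0 : coefs (mono d 0 / mono c 0) 0 = d / c by rewrite mono0V // monoM.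
have G1 : tcoef 0 (theta p (mono c 0 * mono d 0) (a + b)) = theta p (c * d) (a + b).
  by rewrite tcoef0_theta cd0 // unitrM cU.
have G2 : tcoef 0 (theta p (mono d 0 / mono c 0) (b - a)) = theta p (d / c) (b - a).
  by rewrite tcoef0_theta dc0 // unitrM dU unitrV.
have X0 : tcoef 0 (mono (mono c 0) a) = mono c a by rewrite tcoef_mono.
have := tcoef2_three_term E v0 T0 X0 G1 G2
  (fun M => jet2_theta_const M a cU) (fun M => jet2_theta_const M b dU)
  (fun M => jet2_theta_pair M dU _) (fun M => jet2_theta_pair M cU _).
rewrite -exprM; apply; lia.
Qed.

End JetTheta.

Section WpDerivative.
Variable p : nat.
Hypothesis p_gt0 : (0 < p)%N.

(** For y = q^a and x = c y, the factor theta(y/x) = theta(1/c) vanishes at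
    c = 1; its zero is written as c - 1. *)
Lemma wp_sub_diag (R : comUnitRingType) (c : R) a : c \is a GRing.unit ->
  (0 < a)%N -> (2 * a <= p)%N ->
  (wp p c a - wp p 1 a) * (theta p c a ^+ 2 * theta p 1 a ^+ 2) =
  mono (c - 1) 0 *
    (euler R p ^+ 4 * (mono 1 a * theta p c (2 * a) * theta1 p c^-1)).
Proof.
move=> cU a0 a2.
rewrite wp_sub ?unitr1 //; try lia.
rewrite mulr1 mul1r subnn theta_at0 // addnn -mul2n.
have -> : mono c a = mono c 0 * mono 1 a by rewrite monoM mulr1.
have -> : mono (c - 1) 0 = mono c 0 - 1 by rewrite monoD monoN mono1.
have vU : mono c 0 * mono c^-1 0 = 1 by rewrite monoM mulrV // mono1.
rewrite -[in RHS]vU; ring.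
Qed.

(** Comparing coefficients of t^0 first shows that D vanishes at t = 0, so the
    coefficient of t on the left only sees the values of A and B at t = 0. *)
Lemma tcoef1_diag (R : comUnitRingType) (D A B E X G H : fps (fps R))
    (A0 B0 e x g h : fps R) :
  D * (A ^+ 2 * B ^+ 2) = mono (mono 1 1) 0 * (E ^+ 4 * (X * G * H)) ->
  tcoef 0 A = A0 -> tcoef 0 B = B0 -> tcoef 0 E = e -> tcoef 0 X = x ->
  tcoef 0 G = g -> tcoef 0 H = h -> A0 \is a GRing.unit -> B0 \is a GRing.unit ->
  tcoef 1 D * (A0 ^+ 2 * B0 ^+ 2) = e ^+ 4 * (x * g * h).
Proof.
move=> eqD <- <- <- <- <- <- AU BU.
have D0 : tcoef 0 D = 0.
  have ABU : tcoef 0 A ^+ 2 * tcoef 0 B ^+ 2 \is a GRing.unit by rewrite unitrM !unitrX.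
  apply: (mulIr ABU); rewrite mul0r; have := congr1 (tcoef 0) eqD.
  rewrite !expr2 !tcoefM0 => ->.
  by rewrite !tcoef_mono (_ : coefs (mono 1 1) 0 = 0) // mono0 mul0r.
have := congr1 (tcoef 1) eqD; rewrite tcoef_monoM tcoefM1 D0 mul0r add0r.
by rewrite !exprS !expr0 !tcoefM0 !tcoef1.
Qed.

(** The derivative x wp'(x) at x = q^a, as the coefficient of t in
    wp((1 + t) x) - wp(x). *)
Definition wp_deriv (R : comUnitRingType) a : fps R :=
  tcoef 1 (wp p (one_plus_t R) a - wp p 1 a).

Lemma wp_derivE (R : comUnitRingType) a : (0 < a)%N -> (2 * a < p)%N ->
  wp_deriv R a * theta p 1 a ^+ 4 =
  euler R p ^+ 6 * (mono 1 a * theta p 1 (2 * a)).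
Proof.
move=> a0 a2.
have uU : one_plus_t R \is a GRing.unit := one_plus_t_unit R.
have u0U : coefs (one_plus_t R) 0 \is a GRing.unit by rewrite one_plus_t0 unitr1.
have v0U : coefs (one_plus_t R)^-1 0 \is a GRing.unit.
  by rewrite (coefs_inv0 u0U) one_plus_t0 invr1 unitr1.
have E := wp_sub_diag uU a0 (ltnW a2); rewrite one_plus_t_sub1 in E.
have A0 : tcoef 0 (theta p (one_plus_t R) a) = theta p 1 a.
  by rewrite (tcoef0_theta p_gt0 _ u0U) one_plus_t0.
have B0 : tcoef 0 (theta p 1 a) = theta p 1 a :> fps R.
  by rewrite (@tcoef0_theta _ _ p_gt0 1) ?coefs1 ?unitr1.
have G0 : tcoef 0 (theta p (one_plus_t R) (2 * a)) = theta p 1 (2 * a).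
  by rewrite (tcoef0_theta p_gt0 _ u0U) one_plus_t0.
have H0 : tcoef 0 (theta1 p (one_plus_t R)^-1) = euler R p ^+ 2.
  by rewrite (tcoef0_theta1 p_gt0 v0U) (coefs_inv0 u0U) one_plus_t0 invr1 theta1_1.
have E0 : tcoef 0 (euler _ p) = euler R p.
  by rewrite (tcoef0_qpoch p_gt0 1 p) coefs1.
have X0 : tcoef 0 (mono 1 a) = mono 1 a :> fps R by rewrite tcoef_mono coefs1.
have thU : theta p (1 : R) a \is a GRing.unit by apply: theta_unit; lia.
have := tcoef1_diag E A0 B0 E0 X0 G0 H0 thU thU.
by rewrite -exprD => ->; ring.
Qed.

End WpDerivative.

(** * Divisibility of the Lambert coefficients *)
Section Divisibility.
Variables (p a : nat).
Hypotheses (p_pr : prime p) (a_gt0 : (0 < a)%N) (a_lt : (a < p)%N).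

Lemma coefs_wp (R : comUnitRingType) (c : R) n :
  coefs (wp p c a) n = \sum_(k < n.+1)
   (\sum_(m < n.+1) m%:R * c ^+ m *+ (n == m * (a + k * p))%N +
    \sum_(m < n.+1) m%:R * c^-1 ^+ m *+ (n == m * (p - a + k * p))%N).
Proof.
rewrite [LHS]/= coefs_sum; apply: eq_bigr => k _.
by rewrite coefsD !(@coefs_lambert _ _ _ n.+1) //; lia.
Qed.

Lemma coprime_residue e k : (0 < e < p)%N -> coprime p (e + k * p).
Proof.
move=> /andP[e0 ep]; rewrite prime_coprime // dvdn_addl ?dvdn_mull //.
by apply/negP => /(dvdn_leq e0); rewrite leqNgt ep.
Qed.

Lemma dvdn_cofactor j n m e : coprime p e -> (p ^ j * n = m * e)%N -> (p ^ j %| m)%N.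
Proof.
move=> pe E; have : (p ^ j %| m * e)%N by rewrite -E dvdn_mulr.
by rewrite Gauss_dvdl // coprimeXl.
Qed.

Lemma dvdz_wp j n : ((p ^ j)%:Z %| coefs (wp p (1 : int) a) (p ^ j * n))%Z.
Proof.
rewrite coefs_wp rpred_sum // => k _; rewrite rpredD // rpred_sum // => m _.
  case: eqP => [E|]; last by rewrite mulr0n dvdz0.
  rewrite mulr1n expr1n mulr1 natz dvdzE /=.
  by apply: dvdn_cofactor E; apply: coprime_residue; lia.
case: eqP => [E|]; last by rewrite mulr0n dvdz0.
rewrite mulr1n invr1 expr1n mulr1 natz dvdzE /=.
by apply: dvdn_cofactor E; apply: coprime_residue; lia.
Qed.

Lemma coefsX_1 (R : comUnitRingType) (v : fps R) m : coefs v 0 = 1 ->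
  coefs (v ^+ m) 0 = 1 /\ coefs (v ^+ m) 1 = m%:R * coefs v 1.
Proof.
move=> v0; elim: m => [|m [I0 I1]]; first by rewrite expr0 !coefs1 mul0r.
rewrite exprS coefsM0 coefsM !big_ord_recl big_ord0 addr0 v0 I0 mulr1; split=> //.
by rewrite mul1r mulr1 I1 -[m.+1%:R]natr1 mulrDl mul1r.
Qed.

(** The derivative multiplies the term of index m by m once more, whence the
    square of p^j. *)
Lemma dvdz_wp_coef1 j n (v : fps int) : coefs v 0 = 1 ->
  ((p ^ (2 * j))%:Z %| coefs (coefs (wp p v a) (p ^ j * n)) 1)%Z.
Proof.
move=> v0; rewrite coefs_wp coefs_sum rpred_sum // => k _.
have vU : coefs v 0 \is a GRing.unit by rewrite v0 unitr1.
have v0' : coefs v^-1 0 = 1 by rewrite coefs_inv0 // v0 invr1.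
have dvd_term m e (w : fps int) : coefs w 0 = 1 -> (0 < e < p)%N ->
    ((p ^ (2 * j))%:Z %|
       coefs (m%:R * w ^+ m *+ (p ^ j * n == m * (e + k * p))%N) 1)%Z.
  move=> w0 ep; rewrite coefsMn; case: eqP => [E|]; last by rewrite mulr0n dvdz0.
  rewrite mulr1n mulr_natl coefsMn (coefsX_1 m w0).2 -mulrnAl -mulrnA.
  apply: dvdz_mulr; rewrite natz dvdzE /= mulnC expnM expnS expn1.
  by apply: dvdn_mul; apply: dvdn_cofactor E; apply: coprime_residue.
by rewrite coefsD rpredD // coefs_sum rpred_sum // => m _; apply: dvd_term => //; lia.
Qed.

Lemma dvdz_wp_deriv j n : ((p ^ (2 * j))%:Z %| coefs (wp_deriv p int a) (p ^ j * n))%Z.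
Proof.
rewrite [coefs _ _]/= rpredB // dvdz_wp_coef1 ?one_plus_t0 //.
Qed.

End Divisibility.

(** * The four products *)
Section ZeroPaddedVectors.

(** Stated for any commutative monoid, to serve both the product defining the
    generating function and the sums defining ell. *)
Lemma big_zpad (T : Type) (idx : T) (op : Monoid.com_law idx) (G : nat -> int -> T)
    h (p := h.*2.+1) (u v : seq int) :
  (forall i, G i 0 = idx) -> (0 < size u)%N -> (size u + size v <= h.+1)%N ->
  \big[op/idx]_(1 <= i < (p.-1./2).+1) G i (zpad p u v)`_i =
  op (\big[op/idx]_(1 <= i < size u) G i u`_i)
     (\big[op/idx]_(0 <= i < size v) G (h.+1 - size v + i)%N v`_i).
Proof.
move=> G0 u0 uv; rewrite {}/p /= doubleK.
have zE i : (zpad h.*2.+1 u v)`_i = if (i < size u)%N then u`_i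
    else if (i < h.+1 - size v)%N then 0 else v`_(i - (h.+1 - size v)).
  rewrite /zpad -doubleS doubleK !nth_cat size_nseq nth_nseq.
  case: ltnP => // ui.
  have -> : (i - size u - (h.+1 - (size u + size v)) = i - (h.+1 - size v))%N.
    by move: ui uv; move: (size u) (size v) => su sv; lia.
  have -> : (i - size u < h.+1 - (size u + size v))%N = (i < h.+1 - size v)%N.
    by move: ui uv; move: (size u) (size v) => su sv; lia.
  by case: (i < _)%N.
rewrite (@big_cat_nat _ _ _ (size u)) //=; last by lia.
congr (op _ _).
  by apply: eq_big_nat => i /andP[_ iu]; rewrite zE iu.
rewrite (@big_cat_nat _ _ _ (h.+1 - size v)%N) //=; [|lia|lia].
rewrite big_nat_cond big1 ?Monoid.mul1m; last first.
  by move=> i /andP[/andP[h1 h2] _]; rewrite zE ltnNge h1 h2 /=.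
rewrite -{1}[(h.+1 - size v)%N]add0n big_addn.
rewrite (_ : (h.+1 - (h.+1 - size v) = size v)%N); last by lia.
apply: eq_big_nat => i /andP[_ iv]; rewrite zE addnC.
by rewrite !ifF ?addKn //; lia.
Qed.

End ZeroPaddedVectors.

Lemma frac_div (p i : nat) : (i < p)%N -> Defs.frac (i%:R / p%:R) = i%:R / p%:R.
Proof.
move=> ip; rewrite /Defs.frac (_ : Num.floor _ = 0) ?subr0 //.
apply: Num.Theory.floor_def.
have p0 : (0 < p%:R :> rat) by rewrite Num.Theory.ltr0n; lia.
rewrite Num.Theory.divr_ge0 ?Num.Theory.ler0n //= Num.Theory.ltr_pdivrMr //.
by rewrite mul1r Num.Theory.ltr_nat.
Qed.

(** As a < p <= p^j n, the argument p^j n - ell is natural when ell = a. *)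
Lemma P_dvd_of_coefs p s a j n e : (0 < n)%N -> (0 < j)%N -> (a < p)%N ->
  ell p s = a%:R ->
  ((p ^ e)%:Z %| coefs (mono 1 a * Pgen p s) (p ^ j * n))%Z ->
  P_dvd p s j n e.
Proof.
move=> n0 j0 ap ellE; rewrite coefs_monoM mul1r.
have le_a : (a <= p ^ j * n)%N.
  apply: leq_trans (ltnW ap) _; apply: leq_trans (leq_pmulr _ n0).
  by rewrite -{1}[p]expn1 leq_pexp2l //; lia.
rewrite le_a => dvd; exists (p ^ j * n - a)%N%:Z.
  by rewrite ellE -natrB.
by apply/eqP; rewrite eqz_mod_dvd subr0.
Qed.

(** theta(x) = theta(Q/x): this identifies the exponents a and p - a. *)
Lemma theta_sym p a : (a <= p)%N -> theta p (1 : int) (p - a) = theta p 1 a.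
Proof. by move=> ap; rewrite !thetaE invr1 subKn // mulrC. Qed.

Section OddModulus.
Variable h : nat.
Let p := h.*2.+1.
Local Notation th := (theta p (1 : int)).
Local Notation E := (euler int p).

Lemma Pgen_zpad x u v : (size u + size v <= h)%N ->
  Pgen p (zpad p (x :: u) v) =
  E ^ x * ((\prod_(1 <= i < (size u).+1) th i ^ (x :: u)`_i) *
           \prod_(0 <= i < size v) th (h.+1 - size v + i) ^ v`_i).
Proof.
move=> uv; rewrite /Pgen [(zpad _ _ _)`_0]/= (fpsX_mono _ p).
under eq_bigr => i _.
  rewrite (fpsX_mono _ i) (fpsX_mono _ (p - i)).
  rewrite -[qpoch2 _ _ _](_ : th i = _); last by rewrite thetaE invr1.
  over.
by rewrite (@big_zpad _ 1 _ (fun i y => th i ^ y)).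
Qed.

Lemma ell_zpad x u v : (size u + size v <= h)%N ->
  ell p (zpad p (x :: u) v) =
  p%:R / 24%:R * (x%:~R + 2%:R * ((\sum_(1 <= i < (size u).+1) ((x :: u)`_i)%:~R) +
                               \sum_(0 <= i < size v) (v`_i)%:~R))
  - p%:R / 2%:R * ((\sum_(1 <= i < (size u).+1)
        i%:R / p%:R * (1 - i%:R / p%:R) * ((x :: u)`_i)%:~R) +
      \sum_(0 <= i < size v)
        (h.+1 - size v + i)%:R / p%:R *
        (1 - (h.+1 - size v + i)%:R / p%:R) * (v`_i)%:~R).
Proof.
move=> uv; rewrite /ell [(zpad _ _ _)`_0]/=.
rewrite (@big_zpad _ 0 _ (fun _ y => y%:~R)) //.
rewrite (@big_zpad _ 0 _ (fun i y =>
  Defs.frac (i%:R / p%:R) * (1 - Defs.frac (i%:R / p%:R)) * y%:~R)) //; last first.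
  by move=> i; rewrite mulr0.
congr (_ - _ * (_ + _)); apply: eq_big_nat => i iu; rewrite frac_div //.
  by rewrite /p -addnn; move: iu uv => /=; lia.
by rewrite /p -addnn; move: iu uv => /=; lia.
Qed.

Lemma exprz_natN (R : unitRingType) (x : R) k : x ^ (- k%:R) = (x ^+ k)^-1.
Proof. by rewrite natz; case: k => [|k]; rewrite ?oppr0 ?invr1 // -NegzE. Qed.
Lemma exprz_nat (R : unitRingType) (x : R) k : x ^ (k%:R : int) = x ^+ k.
Proof. by rewrite natz. Qed.

Let thU i : (0 < i < p)%N -> th i \is a GRing.unit.
Proof. exact: theta_unit. Qed.

Lemma Pgen_6_1_N4 : (1 < h)%N ->
  mono 1 h * Pgen p (zpad p [:: 6; 1] [:: - 4]) = wp_deriv p int h.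
Proof.
move=> h_gt1; have hU : th h \is a GRing.unit by apply: thU; rewrite /p; lia.
rewrite Pgen_zpad //=.
rewrite !big_nat1 /= subn1 addn0 /= expr1z exprz_natN exprz_nat.
have U4 : th h ^+ 4 \is a GRing.unit by rewrite unitrX.
apply: (mulIr U4); rewrite wp_derivE //; [|lia|by rewrite /p; lia].
have -> : (2 * h)%N = (p - 1)%N by rewrite /p mul2n subn1.
rewrite theta_sym //.
transitivity (E ^+ 6 * (mono 1 h * th 1) * ((th h ^+ 4)^-1 * th h ^+ 4)); first by ring.
by rewrite mulVr // mulr1.
Qed.

Let p_rat : p%:R = 2 * h%:R + 1 :> rat.
Proof. by rewrite /p -addn1 -mul2n natrD natrM. Qed.
Let p_neq0 : p%:R != 0 :> rat.
Proof. by rewrite Num.Theory.pnatr_eq0. Qed.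

Lemma ell_6_1_N4 : (1 < h)%N -> ell p (zpad p [:: 6; 1] [:: - 4]) = h%:R.
Proof.
move=> h_gt1; rewrite ell_zpad //=.
rewrite !big_nat1 /= subn1 addn0 /=.
rewrite !mulrNz !mulrz_nat !mulr1z.
have p0 := p_neq0; have pE := p_rat; rewrite pE in p0 *; field.
done.
Qed.

Lemma wp_sub_quotient a b : (0 < a)%N -> (a <= b < p)%N -> (a + b <= p)%N ->
  wp p (1 : int) a - wp p 1 b =
  E ^+ 4 * (mono 1 a * th (a + b) * th (b - a)) * (th a ^- 2 * th b ^- 2).
Proof.
move=> a0 ab abp; have aU : th a \is a GRing.unit by apply: thU; lia.
have bU : th b \is a GRing.unit by apply: thU; lia.
have := @wp_sub int p isT 1 1 a b (unitr1 _) (unitr1 _) a0 ab abp.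
rewrite (divr1 1) => <-; set x := th a in aU *; set y := th b in bU *.
transitivity ((wp p 1 a - wp p 1 b) * (x ^+ 2 / x ^+ 2) * (y ^+ 2 / y ^+ 2)); last by ring.
by rewrite !mulrV ?unitrX // !mulr1.
Qed.

Hypothesis h_gt4 : (4 < h)%N.

Lemma Pgen_4_N2_1_N2_1 : mono 1 1 * Pgen p (zpad p [:: 4; - 2] [:: 1; - 2; 1]) =
  wp p 1 1 - wp p 1 (h - 1).
Proof.
rewrite wp_sub_quotient; [|lia|rewrite /p; lia|rewrite /p; lia].
rewrite Pgen_zpad /=; last by lia.
rewrite (big_ltn (m := 0)) // (big_ltn (m := 1) (n := 3)) // !big_nat1 /=.
rewrite !expr1z !exprz_natN exprz_nat.
rewrite (_ : h.+1 - 3 + 0 = h - 1 - 1)%N; last by lia.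
rewrite (_ : h.+1 - 3 + 1 = h - 1)%N; last by lia.
rewrite (_ : h.+1 - 3 + 2 = 1 + (h - 1))%N; last by lia.
ring.
Qed.

Lemma Pgen_4_N2_1_N1 : mono 1 1 * Pgen p (zpad p [:: 4; - 2] [:: 1; - 1]) =
  wp p 1 1 - wp p 1 h.
Proof.
rewrite wp_sub_quotient; [|lia|rewrite /p; lia|rewrite /p; lia].
rewrite Pgen_zpad /=; last by lia.
have hU : th h \is a GRing.unit by rewrite thU // /p; lia.
rewrite (big_ltn (m := 0)) // !big_nat1 /= !expr1z exprN1 !exprz_natN exprz_nat.
rewrite (_ : h.+1 - 2 + 0 = h - 1)%N; last by lia.
rewrite (_ : h.+1 - 2 + 1 = h)%N; last by lia.
have -> : th (1 + h) = th h.
  by rewrite -[LHS](theta_sym (p := p)); [congr theta|]; rewrite /p; lia.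
have -> : th h ^- 2 = (th h)^-1 * (th h)^-1 by rewrite expr2 invrM.
set x := th h; set y := (th 1 ^+ 2)^-1.
transitivity (E ^+ 4 * (mono 1 1 * th (h - 1)) * x^-1 * y * 1); first by ring.
by rewrite -(mulrV hU) -/x; ring.
Qed.

Lemma Pgen_4_1_1_N2_N2 :
  mono 1 (h - 1) * Pgen p (zpad p [:: 4; 1; 1] [:: - 2; - 2]) =
  wp p 1 (h - 1) - wp p 1 h.
Proof.
rewrite wp_sub_quotient; [|lia|rewrite /p; lia|rewrite /p; lia].
rewrite Pgen_zpad /=; last by lia.
rewrite (big_ltn (m := 0)) // (big_ltn (m := 1) (n := 3)) // !big_nat1 /=.
rewrite !expr1z !exprz_natN exprz_nat.
rewrite (_ : h.+1 - 2 + 0 = h - 1)%N; last by lia.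
rewrite (_ : h.+1 - 2 + 1 = h)%N; last by lia.
rewrite (_ : h - (h - 1) = 1)%N; last by lia.
have -> : th (h - 1 + h) = th 2.
  by rewrite -[RHS](theta_sym (p := p)); [congr theta|]; rewrite /p; lia.
ring.
Qed.

Lemma ell_4_N2_1_N2_1 : ell p (zpad p [:: 4; - 2] [:: 1; - 2; 1]) = 1%:R.
Proof.
rewrite ell_zpad /=; last by lia.
rewrite !(big_ltn (m := 0)) // !(big_ltn (m := 1)) //.
rewrite !(big_ltn (m := 2) (n := 3)) // !big_geq //=.
rewrite !mulrNz !mulrz_nat !mulr1z.
rewrite (_ : h.+1 - 3 + 0 = h - 2)%N; last by lia.
rewrite (_ : h.+1 - 3 + 1 = h - 1)%N; last by lia.
rewrite (_ : h.+1 - 3 + 2 = h)%N; last by lia.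
rewrite !natrB; [|lia|lia].
by have p0 := p_neq0; have pE := p_rat; rewrite pE in p0 *; field.
Qed.

Lemma ell_4_N2_1_N1 : ell p (zpad p [:: 4; - 2] [:: 1; - 1]) = 1%:R.
Proof.
rewrite ell_zpad /=; last by lia.
rewrite !(big_ltn (m := 0)) // !(big_ltn (m := 1)) // !big_geq //=.
rewrite !mulrNz !mulrz_nat !mulr1z.
rewrite (_ : h.+1 - 2 + 0 = h - 1)%N; last by lia.
rewrite (_ : h.+1 - 2 + 1 = h)%N; last by lia.
rewrite !natrB; [|lia].
by have p0 := p_neq0; have pE := p_rat; rewrite pE in p0 *; field.
Qed.

Lemma ell_4_1_1_N2_N2 : ell p (zpad p [:: 4; 1; 1] [:: - 2; - 2]) = (h - 1)%:R.
Proof.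
rewrite ell_zpad /=; last by lia.
rewrite !(big_ltn (m := 0)) // !(big_ltn (m := 1)) //.
rewrite !(big_ltn (m := 2) (n := 3)) // !big_geq //=.
rewrite !mulrNz !mulrz_nat !mulr1z.
rewrite (_ : h.+1 - 2 + 0 = h - 1)%N; last by lia.
rewrite (_ : h.+1 - 2 + 1 = h)%N; last by lia.
rewrite !natrB; [|lia].
by have p0 := p_neq0; have pE := p_rat; rewrite pE in p0 *; field.
Qed.

End OddModulus.

Theorem corollary7p1 (n j p : nat) (n_gt0 : (0 < n)%N) (j_gt0 : (0 < j)%N)
    (p_prime : prime p) :
  [/\ (5 <= p <= 101)%N ->
        P_dvd p (zpad p [:: 6; 1] [:: - 4]) j n (2 * j),
      (11 <= p <= 101)%N ->
        P_dvd p (zpad p [:: 4; - 2] [:: 1; - 2; 1]) j n j,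
      (11 <= p <= 101)%N ->
        P_dvd p (zpad p [:: 4; - 2] [:: 1; - 1]) j n j
    & (11 <= p <= 101)%N ->
        P_dvd p (zpad p [:: 4; 1; 1] [:: - 2; - 2]) j n j].
Proof.
have odd_form : (5 <= p)%N -> exists h, p = h.*2.+1.
  move=> p5; case: (even_prime p_prime) => [p2|p_odd]; first by rewrite p2 in p5.
  by exists p./2; rewrite -[LHS]odd_double_half p_odd.
split=> /andP[p_ge _]; have [|h pE] := odd_form; try lia; subst p.
- have h2 : (1 < h)%N by lia.
  apply: (@P_dvd_of_coefs _ _ h) => //; [lia | exact: ell_6_1_N4 |].
  rewrite Pgen_6_1_N4 //.
  by apply: dvdz_wp_deriv => //; lia.
all: have h5 : (4 < h)%N by lia.
- apply: (@P_dvd_of_coefs _ _ 1) => //; [lia | exact: ell_4_N2_1_N2_1 |].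
  by rewrite Pgen_4_N2_1_N2_1 // coefsD coefsN rpredB // dvdz_wp //; lia.
- apply: (@P_dvd_of_coefs _ _ 1) => //; [lia | exact: ell_4_N2_1_N1 |].
  by rewrite Pgen_4_N2_1_N1 // coefsD coefsN rpredB // dvdz_wp //; lia.
- apply: (@P_dvd_of_coefs _ _ (h - 1)) => //; [lia | exact: ell_4_1_1_N2_N2 |].
  by rewrite Pgen_4_1_1_N2_N2 // coefsD coefsN rpredB // dvdz_wp //; lia.
Qed.
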